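(* Let $\Pi$ be the preprojective algebra (over $\mathbb C$) of type ADE with Dynkin diagram $\Delta$, and let $\mathcal I\subseteq\Delta$. Then every brick in $\operatorname{mod}e_{\mathcal I}\Pi e_{\mathcal I}$ has dimension vector equal to a primitive restricted root.
   Context: $\Pi$ is the preprojective algebra of the (finite) ADE diagram $\Delta$ with vertex idempotents $e_i$, $i\in\Delta$, and $e_{\mathcal I}=1-\sum_{i\in\mathcal I}e_i$. A brick is a finite dimensional module $x$ with $\operatorname{Hom}(x,x)\cong\mathbb C$. The dimension vector of an $e_{\mathcal I}\Pi e_{\mathcal I}$-module lies in $\mathbb Z^{\Delta\setminus\mathcal I}$. Restricted roots: let $\mathfrak h=\bigoplus_{i\in\Delta}\mathbb R\alpha_i$ where $\alpha_i$ are the simple roots, let $\mathfrak h_{\mathcal I}$ be the quotient of $\mathfrak h$ by the span of $\{\alpha_i\mid i\in\mathcal I\}$, and $\pi_{\mathcal I}\colon\mathfrak h\to\mathfrak h_{\mathcal I}$ the quotient map. The space $\mathfrak h_{\mathcal I}$ has basis $\{\pi_{\mathcal I}(\alpha_j)\mid j\in\Delta\setminus\mathcal I\}$, through which $\mathbb Z^{\Delta\setminus\mathcal I}$ is identified with a subset of $\mathfrak h_{\mathcal I}$. The restricted positive roots are the nonzero images under $\pi_{\mathcal I}$ of the positive roots of $\Delta$. A restricted positive root is primitive if it is not a multiple of another restricted positive root. *)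

(* Defs.v *)
Set Warnings "-notation-overridden,-ambiguous-paths,-redundant-canonical-projection".
From HB Require Import structures.
From mathcomp Require Import all_boot all_order all_algebra generic_quotient ring_quotient.
From mathcomp Require Import boolp reals.
From mathcomp Require Import complex.

Set Implicit Arguments.
Unset Strict Implicit.
Unset Printing Implicit Defensive.

Import GRing.Theory.
Local Open Scope ring_scope.
Local Open Scope quotient_scope.

(* The path algebra of the quiver with vertex set V and exactly one arrow
   i -> j when adj i j.  Having no parallel arrows, a path is the sequence of
   vertices (i, w) it visits, from its source i; the constant path at i is
   (i, [::]).  Elements are finitely supported coefficient functions, and the
   product of paths p * q is p followed by q. *)
Section PathAlgebra.
Variables (K : fieldType) (V : finType) (adj : rel V).

Record pathAlg := PathAlg {
  coef :> V * seq V -> K;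
  coef_path : forall p, ~~ path adj p.1 p.2 -> coef p = 0;
  coef_fin : exists s : seq (V * seq V), forall p, p \notin s -> coef p = 0
}.

HB.instance Definition _ := gen_eqMixin pathAlg.
HB.instance Definition _ := gen_choiceMixin pathAlg.

Lemma pathAlg_eq (f g : pathAlg) : coef f =1 coef g -> f = g.
Proof.
case: f g => f f1 f2 [g g1 g2] /= /funext fg.
by move: g1 g2; rewrite -fg => g1 g2; congr PathAlg; exact: Prop_irrelevance.
Qed.

Implicit Types (f g h : V * seq V -> K) (p : V * seq V).

Definition conv f g p : K :=
  \sum_(k < (size p.2).+1)
    f (p.1, take k p.2) * g (last p.1 (take k p.2), drop k p.2).

Lemma conv_nil f g i : conv f g (i, [::]) = f (i, [::]) * g (i, [::]).
Proof. by rewrite /conv /= big_ord1. Qed.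

Lemma conv_cons f g i j w : conv f g (i, j :: w) =
  f (i, [::]) * g (i, j :: w) + conv (fun q => f (i, q.1 :: q.2)) g (j, w).
Proof. by rewrite /conv /= big_ord_recl. Qed.

Lemma convDl f g h p : conv (fun q => f q + g q) h p = conv f h p + conv g h p.
Proof. by rewrite -big_split; apply: eq_bigr => k _; rewrite mulrDl. Qed.

Lemma convDr f g h p : conv f (fun q => g q + h q) p = conv f g p + conv f h p.
Proof. by rewrite -big_split; apply: eq_bigr => k _; rewrite mulrDr. Qed.

Lemma convZl a f g p : conv (fun q => a * f q) g p = a * conv f g p.
Proof. by rewrite mulr_sumr; apply: eq_bigr => k _; rewrite mulrA. Qed.

Lemma convZr a f g p : conv f (fun q => a * g q) p = a * conv f g p.
Proof. by rewrite mulr_sumr; apply: eq_bigr => k _; rewrite mulrCA. Qed.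

Lemma eq_convl f f' g p : f =1 f' -> conv f g p = conv f' g p.
Proof. by move=> ff'; apply: eq_bigr => k _; rewrite ff'. Qed.

Lemma convA f g h p : conv f (conv g h) p = conv (conv f g) h p.
Proof.
case: p => i w; elim: w i f => [|j w IHw] i f; first by rewrite !conv_nil mulrA.
rewrite !conv_cons conv_nil mulrDr IHw mulrA -addrA; congr (_ + _).
rewrite -convZl -convDl; apply: eq_convl => -[k u] /=.
by rewrite conv_cons.
Qed.

Definition idf p : K := (p.2 == [::])%:R.

Lemma conv1l f p : conv idf f p = f p.
Proof.
case: p => i w; rewrite /conv big_ord_recl /= take0 drop0 mul1r big1 ?addr0 //.
by case: w => [|j w] k _; rewrite ?mul0r //; case: k.
Qed.

Lemma conv1r f p : conv f idf p = f p.
Proof.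
case: p => i w; rewrite /conv big_ord_recr /= take_size drop_size mulr1.
rewrite big1 ?add0r // => k _; rewrite /idf /= -size_eq0 size_drop subn_eq0.
by rewrite leqNgt ltn_ord mulr0.
Qed.

Fact zero_path p : ~~ path adj p.1 p.2 -> 0 = 0 :> K. Proof. by []. Qed.
Fact zero_fin : exists s : seq (V * seq V), forall p, p \notin s -> 0 = 0 :> K.
Proof. by exists [::]. Qed.
Definition pzero := PathAlg zero_path zero_fin.

Fact add_path (f g : pathAlg) p : ~~ path adj p.1 p.2 -> f p + g p = 0.
Proof. by move=> np; rewrite !coef_path ?addr0. Qed.
Fact add_fin (f g : pathAlg) :
  exists s : seq (V * seq V), forall p, p \notin s -> f p + g p = 0.
Proof.
case: (coef_fin f) (coef_fin g) => s Hs [t Ht]; exists (s ++ t) => p.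
by rewrite mem_cat negb_or => /andP[/Hs-> /Ht->]; rewrite addr0.
Qed.
Definition padd (f g : pathAlg) := PathAlg (@add_path f g) (add_fin f g).

Fact scale_path a (f : pathAlg) p : ~~ path adj p.1 p.2 -> a * f p = 0.
Proof. by move=> np; rewrite !coef_path ?mulr0. Qed.
Fact scale_fin a (f : pathAlg) :
  exists s : seq (V * seq V), forall p, p \notin s -> a * f p = 0.
Proof. by case: (coef_fin f) => s Hs; exists s => p /Hs ->; rewrite mulr0. Qed.
Definition pscale a (f : pathAlg) := PathAlg (@scale_path a f) (scale_fin a f).

Fact one_path p : ~~ path adj p.1 p.2 -> idf p = 0.
Proof. by case: p => i []. Qed.
Fact one_fin : exists s : seq (V * seq V), forall p, p \notin s -> idf p = 0.
Proof.
exists [seq (i, [::]) | i : V] => -[i [|j w]] // /negP[].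
by apply/imageP; exists i.
Qed.
Definition pone := PathAlg one_path one_fin.

Fact mul_path (f g : pathAlg) p : ~~ path adj p.1 p.2 -> conv f g p = 0.
Proof.
case: p => i w np; apply: big1 => k _ /=.
move: np; rewrite /= -{1}(cat_take_drop k w) cat_path negb_and => /orP[] np.
  by rewrite coef_path ?mul0r.
by rewrite (@coef_path g (_, _) np) mulr0.
Qed.
Fact mul_fin (f g : pathAlg) :
  exists s : seq (V * seq V), forall p, p \notin s -> conv f g p = 0.
Proof.
case: (coef_fin f) (coef_fin g) => s Hs [t Ht].
exists [seq (p.1, p.2 ++ q.2) | p <- s, q <- t] => -[i w] nst.
apply: big1 => k _ /=; have [sk|/Hs->] := boolP ((i, take k w) \in s); last first.
  by rewrite mul0r.
have [tk|/Ht->] := boolP ((last i (take k w), drop k w) \in t); last first.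
  by rewrite mulr0.
case/negP: nst; apply/allpairsP.
exists ((i, take k w), (last i (take k w), drop k w)).
by rewrite /= cat_take_drop.
Qed.
Definition pmul (f g : pathAlg) := PathAlg (@mul_path f g) (mul_fin f g).

Fact paddA : associative padd.
Proof. by move=> f g h; apply: pathAlg_eq => p; rewrite /= addrA. Qed.
Fact paddC : commutative padd.
Proof. by move=> f g; apply: pathAlg_eq => p; rewrite /= addrC. Qed.
Fact padd0 : left_id pzero padd.
Proof. by move=> f; apply: pathAlg_eq => p; rewrite /= add0r. Qed.
Fact paddN : left_inverse pzero (pscale (-1)) padd.
Proof. by move=> f; apply: pathAlg_eq => p; rewrite /= mulN1r addNr. Qed.
HB.instance Definition _ :=
  GRing.isZmodule.Build pathAlg paddA paddC padd0 paddN.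

Fact pmulA : associative pmul.
Proof. by move=> f g h; apply: pathAlg_eq => p; rewrite /= convA. Qed.
Fact pmul1l : left_id pone pmul.
Proof. by move=> f; apply: pathAlg_eq => p; rewrite /= conv1l. Qed.
Fact pmul1r : right_id pone pmul.
Proof. by move=> f; apply: pathAlg_eq => p; rewrite /= conv1r. Qed.
Fact pmulDl : left_distributive pmul padd.
Proof. by move=> f g h; apply: pathAlg_eq => p; rewrite /= convDl. Qed.
Fact pmulDr : right_distributive pmul padd.
Proof. by move=> f g h; apply: pathAlg_eq => p; rewrite /= convDr. Qed.
HB.instance Definition _ :=
  GRing.Zmodule_isPzRing.Build pathAlg pmulA pmul1l pmul1r pmulDl pmulDr.

Fact pscaleA a b (f : pathAlg) : pscale a (pscale b f) = pscale (a * b) f.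
Proof. by apply: pathAlg_eq => p; rewrite /= mulrA. Qed.
Fact pscale1 : left_id 1 pscale.
Proof. by move=> f; apply: pathAlg_eq => p; rewrite /= mul1r. Qed.
Fact pscaleDr : right_distributive pscale +%R.
Proof. by move=> a f g; apply: pathAlg_eq => p; rewrite /= mulrDr. Qed.
Fact pscaleDl (f : pathAlg) : {morph pscale^~ f : a b / a + b}.
Proof. by move=> a b; apply: pathAlg_eq => p; rewrite /= mulrDl. Qed.
HB.instance Definition _ := GRing.Zmodule_isLmodule.Build K pathAlg
  pscaleA pscale1 pscaleDr pscaleDl.

Fact pscaleAl (a : K) (f g : pathAlg) : a *: (f * g) = a *: f * g.
Proof. by apply: pathAlg_eq => p; rewrite /= convZl. Qed.
Fact pscaleAr (a : K) (f g : pathAlg) : a *: (f * g) = f * (a *: g).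
Proof. by apply: pathAlg_eq => p; rewrite /= convZr. Qed.

Definition path_fun (p q : V * seq V) : K :=
  (path adj p.1 p.2 && (q == p))%:R.
Fact path_fun_path p q : ~~ path adj q.1 q.2 -> path_fun p q = 0.
Proof.
by rewrite /path_fun; have [->|_] := eqVneq q p; rewrite ?andbF // => /negPf->.
Qed.
Fact path_fun_fin p :
  exists s : seq (V * seq V), forall q, q \notin s -> path_fun p q = 0.
Proof.
by exists [:: p] => q; rewrite inE /path_fun => /negPf ->; rewrite andbF.
Qed.
(* the basis element of a path, and 0 on a sequence that is not a path *)
Definition pathE p : pathAlg := PathAlg (@path_fun_path p) (path_fun_fin p).

Definition vertexP (i : V) : pathAlg := pathE (i, [::]).
Definition arrowP (i j : V) : pathAlg := pathE (i, [:: j]).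

Lemma vertexP_mul i j :
  vertexP i * vertexP j = if i == j then vertexP i else 0.
Proof.
apply: pathAlg_eq => -[k [|l w]].
  rewrite [LHS]conv_nil /= /path_fun !xpair_eqE !andbT -natrM mulnb.
  have [->|ij] := eqVneq i j; first by rewrite andbb /= /path_fun xpair_eqE andbT.
  by case: eqP => //= ->; rewrite (negPf ij).
transitivity (0 : K); last first.
  by case: eqP => // _; rewrite /= /path_fun xpair_eqE andbF.
rewrite [LHS]big1 // => -[[|m] ?] _; last first.
  by rewrite /= /path_fun !xpair_eqE !andbF mul0r.
by rewrite /= /path_fun !xpair_eqE !andbF mulr0.
Qed.

End PathAlgebra.

Section IdealQuotient.
Variables (K : fieldType) (A : algType K) (G : A -> Prop).

Inductive in_ideal : A -> Prop :=
  | ideal_gen x of G x : in_ideal x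
  | ideal0 : in_ideal 0
  | idealD x y of in_ideal x & in_ideal y : in_ideal (x + y)
  | idealMl x y of in_ideal y : in_ideal (x * y)
  | idealMr x y of in_ideal x : in_ideal (x * y).

Definition ideal : {pred A} := fun x => `[< in_ideal x >].

Lemma idealP x : reflect (in_ideal x) (x \in ideal).
Proof. exact: asboolP. Qed.

Fact ideal_zmod_closed : zmod_closed ideal.
Proof.
split=> [|x y /idealP Ix /idealP Iy]; first by apply/idealP; exact: ideal0.
by apply/idealP; apply: idealD => //; rewrite -mulN1r; exact: idealMl.
Qed.
HB.instance Definition _ := GRing.isZmodClosed.Build A ideal ideal_zmod_closed.

Definition quotAlg := {ideal_quot ideal}.
HB.instance Definition _ := GRing.Zmodule.on quotAlg.

Definition qpi (x : A) : quotAlg := \pi_({ideal_quot ideal}) x.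
Definition qrepr (x : quotAlg) : A := repr x.

Lemma qreprK : cancel qrepr qpi. Proof. by move=> x; exact: reprK. Qed.

Lemma qpi_eqP x y : reflect (in_ideal (x - y)) (qpi x == qpi y).
Proof. by rewrite -Quotient.idealrBE; exact: idealP. Qed.

Lemma qpiD x y : qpi (x + y) = qpi x + qpi y.
Proof. by rewrite /qpi !piE. Qed.

Definition qone : quotAlg := qpi 1.
Definition qmul (x y : quotAlg) : quotAlg := qpi (qrepr x * qrepr y).
Definition qscale (a : K) (x : quotAlg) : quotAlg := qpi (a *: qrepr x).

Lemma qrepr_pi x : in_ideal (qrepr (qpi x) - x).
Proof. by apply/qpi_eqP; rewrite qreprK. Qed.

Lemma qpiM x y : qpi (x * y) = qmul (qpi x) (qpi y).
Proof.
apply/esym/eqP/qpi_eqP; set x' := qrepr _; set y' := qrepr _.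
rewrite (_ : _ - _ = (x' - x) * y' + x * (y' - y)).
  by apply: idealD; [apply: idealMr|apply: idealMl]; exact: qrepr_pi.
by rewrite mulrBl mulrBr addrA subrK.
Qed.

Lemma qpiZ a x : qpi (a *: x) = qscale a (qpi x).
Proof.
apply/esym/eqP/qpi_eqP; rewrite -scalerBr -[qrepr _ - _]mul1r scalerAl.
by apply: idealMl; exact: qrepr_pi.
Qed.

Fact qmulA : associative qmul.
Proof.
by move=> x y z; rewrite -[x]qreprK -[y]qreprK -[z]qreprK -!qpiM mulrA.
Qed.
Fact qmul1l : left_id qone qmul.
Proof. by move=> x; rewrite -[x]qreprK -qpiM mul1r. Qed.
Fact qmul1r : right_id qone qmul.
Proof. by move=> x; rewrite -[x]qreprK -qpiM mulr1. Qed.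
Fact qmulDl : left_distributive qmul +%R.
Proof.
move=> x y z; rewrite -[x]qreprK -[y]qreprK -[z]qreprK.
by rewrite -qpiD -!qpiM -qpiD mulrDl.
Qed.
Fact qmulDr : right_distributive qmul +%R.
Proof.
move=> x y z; rewrite -[x]qreprK -[y]qreprK -[z]qreprK.
by rewrite -qpiD -!qpiM -qpiD mulrDr.
Qed.
HB.instance Definition _ :=
  GRing.Zmodule_isPzRing.Build quotAlg qmulA qmul1l qmul1r qmulDl qmulDr.

Fact qscaleA a b x : qscale a (qscale b x) = qscale (a * b) x.
Proof. by rewrite -[x]qreprK -!qpiZ scalerA. Qed.
Fact qscale1 : left_id 1 qscale.
Proof. by move=> x; rewrite -[x]qreprK -qpiZ scale1r. Qed.
Fact qscaleDr : right_distributive qscale +%R.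
Proof.
by move=> a x y; rewrite -[x]qreprK -[y]qreprK -qpiD -!qpiZ -qpiD scalerDr.
Qed.
Fact qscaleDl x : {morph qscale^~ x : a b / a + b}.
Proof. by move=> a b; rewrite -[x]qreprK -!qpiZ -qpiD scalerDl. Qed.
HB.instance Definition _ := GRing.Zmodule_isLmodule.Build K quotAlg
  qscaleA qscale1 qscaleDr qscaleDl.

Fact qscaleAl (a : K) (x y : quotAlg) : a *: (x * y) = a *: x * y.
Proof.
rewrite -[x]qreprK -[y]qreprK.
by rewrite -[LHS]/(qscale _ (qmul _ _)) -[RHS]/(qmul (qscale _ _) _)
  -!(qpiM, qpiZ) scalerAl.
Qed.
Fact qscaleAr (a : K) (x y : quotAlg) : a *: (x * y) = x * (a *: y).
Proof.
rewrite -[x]qreprK -[y]qreprK.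
by rewrite -[LHS]/(qscale _ (qmul _ _)) -[RHS]/(qmul _ (qscale _ _))
  -!(qpiM, qpiZ) scalerAr.
Qed.
End IdealQuotient.

(* The algebra e A e, with unit e, for an idempotent e of A. *)
Section Corner.
Variables (K : fieldType) (A : algType K).

Record idempotent :=
  Idempotent { idem_val : A; idemP : idem_val * idem_val = idem_val }.

Variable e : idempotent.
Local Notation ev := (idem_val e).

Record corner :=
  Corner { corner_val : A; _ : ev * corner_val * ev == corner_val }.
HB.instance Definition _ := [isSub for corner_val].
HB.instance Definition _ := [Choice of corner by <:].

Implicit Types x y : corner.

Lemma cornerl x : ev * val x = val x.
Proof. by rewrite -(eqP (valP x)) !mulrA idemP. Qed.
Lemma cornerr x : val x * ev = val x.
Proof. by rewrite -(eqP (valP x)) -!mulrA idemP. Qed.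

Fact corner0 : ev * 0 * ev == 0. Proof. by rewrite mulr0 mul0r. Qed.
Fact cornerD x y : ev * (val x + val y) * ev == val x + val y.
Proof. by rewrite mulrDr mulrDl !cornerl !cornerr. Qed.
Fact cornerN x : ev * (- val x) * ev == - val x.
Proof. by rewrite mulrN mulNr cornerl cornerr. Qed.
Fact corner1 : ev * ev * ev == ev. Proof. by rewrite !idemP. Qed.
Fact cornerM x y : ev * (val x * val y) * ev == val x * val y.
Proof. by rewrite mulrA cornerl -mulrA cornerr. Qed.
Fact cornerZ (a : K) x : ev * (a *: val x) * ev == a *: val x.
Proof. by rewrite -scalerAr -scalerAl cornerl cornerr. Qed.

Definition cadd x y := Corner (cornerD x y).
Definition copp x := Corner (cornerN x).
Definition cmul x y := Corner (cornerM x y).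
Definition cscale a x := Corner (cornerZ a x).

Fact caddA : associative cadd.
Proof. by move=> x y z; apply: val_inj; rewrite /= addrA. Qed.
Fact caddC : commutative cadd.
Proof. by move=> x y; apply: val_inj; rewrite /= addrC. Qed.
Fact cadd0 : left_id (Corner corner0) cadd.
Proof. by move=> x; apply: val_inj; rewrite /= add0r. Qed.
Fact caddN : left_inverse (Corner corner0) copp cadd.
Proof. by move=> x; apply: val_inj; rewrite /= addNr. Qed.
HB.instance Definition _ :=
  GRing.isZmodule.Build corner caddA caddC cadd0 caddN.

Fact cmulA : associative cmul.
Proof. by move=> x y z; apply: val_inj; rewrite /= mulrA. Qed.
Fact cmul1l : left_id (Corner corner1) cmul.
Proof. by move=> x; apply: val_inj; rewrite /= cornerl. Qed.
Fact cmul1r : right_id (Corner corner1) cmul.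
Proof. by move=> x; apply: val_inj; rewrite /= cornerr. Qed.
Fact cmulDl : left_distributive cmul cadd.
Proof. by move=> x y z; apply: val_inj; rewrite /= mulrDl. Qed.
Fact cmulDr : right_distributive cmul cadd.
Proof. by move=> x y z; apply: val_inj; rewrite /= mulrDr. Qed.
HB.instance Definition _ :=
  GRing.Zmodule_isPzRing.Build corner cmulA cmul1l cmul1r cmulDl cmulDr.

Fact cscaleA a b x : cscale a (cscale b x) = cscale (a * b) x.
Proof. by apply: val_inj; rewrite /= scalerA. Qed.
Fact cscale1 : left_id 1 cscale.
Proof. by move=> x; apply: val_inj; rewrite /= scale1r. Qed.
Fact cscaleDr : right_distributive cscale +%R.
Proof. by move=> a x y; apply: val_inj; rewrite /= scalerDr. Qed.
Fact cscaleDl x : {morph cscale^~ x : a b / a + b}.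
Proof. by move=> a b; apply: val_inj; rewrite /= scalerDl. Qed.
HB.instance Definition _ := GRing.Zmodule_isLmodule.Build K corner
  cscaleA cscale1 cscaleDr cscaleDl.

Fact cscaleAl (a : K) x y : a *: (x * y) = a *: x * y.
Proof. by apply: val_inj; rewrite /= scalerAl. Qed.
Fact cscaleAr (a : K) x y : a *: (x * y) = x * (a *: y).
Proof. by apply: val_inj; rewrite /= scalerAr. Qed.
End Corner.

Section Modules.
Variables (K : fieldType) (A : algType K) (e : idempotent A).

(* finite dimensional left e A e-modules *)
Record fdmod := FdMod {
  carrier :> vectType K;
  act : {linear corner e -> 'End(carrier)};
  act1 : act 1 = \1%VF;
  actM : forall x y, act (x * y) = (act x \o act y)%VF
}.

Definition is_modhom (M N : fdmod) (f : 'Hom(M, N)) : Prop :=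
  forall x : corner e, (f \o act M x = act N x \o f)%VF.

(* Hom(M, M) is isomorphic to K *)
Definition brick (M : fdmod) : Prop :=
  exists phi : {linear K^o -> 'End(M)},
    injective phi /\ forall f : 'End(M), is_modhom f <-> exists c, phi c = f.

End Modules.

(* TypeA n is A_(n+1) and TypeD n is D_(n+4). *)
Inductive ADE := TypeA of nat | TypeD of nat | TypeE6 | TypeE7 | TypeE8.

Definition rank (Delta : ADE) : nat :=
  match Delta with
  | TypeA n => n.+1 | TypeD n => n.+4
  | TypeE6 => 6 | TypeE7 => 7 | TypeE8 => 8
  end.

(* A chain 0 - 1 - ... - (m-2) together with the vertex m-1 joined to b. *)
Definition tree_edge (m b i j : nat) : bool :=
  ((j == i.+1) && (j < m.-1)%N) || ((i == b) && (j == m.-1)).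

(* each edge is listed once, oriented from its smaller vertex to the larger *)
Definition edge (Delta : ADE) (i j : 'I_(rank Delta)) : bool :=
  match Delta with
  | TypeA n => val j == (val i).+1
  | TypeD n => tree_edge n.+4 n.+1 (val i) (val j)
  | TypeE6 => tree_edge 6 2 (val i) (val j)
  | TypeE7 => tree_edge 7 2 (val i) (val j)
  | TypeE8 => tree_edge 8 2 (val i) (val j)
  end.

Lemma rank_gt0 (Delta : ADE) : (0 < rank Delta)%N. Proof. by case: Delta. Qed.

Definition adjacent (Delta : ADE) : rel 'I_(rank Delta) :=
  [rel i j | edge i j || edge j i].

Section Preprojective.
Variables (K : fieldType) (Delta : ADE).
Local Notation vtx := 'I_(rank Delta).

Definition doublePathAlg := pathAlg K (@adjacent Delta).
HB.instance Definition _ := GRing.PzRing.on doublePathAlg.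
HB.instance Definition _ := GRing.Lmodule.on doublePathAlg.

Fact doublePathAlg_nonzero : (1 : doublePathAlg) != 0.
Proof.
apply/eqP => /(congr1 (fun f : doublePathAlg => f (Ordinal (rank_gt0 Delta), [::]))).
by move/eqP; rewrite oner_eq0.
Qed.
HB.instance Definition _ :=
  GRing.PzSemiRing_isNonZero.Build doublePathAlg doublePathAlg_nonzero.
HB.instance Definition _ := GRing.LSemiModule_isLSemiAlgebra.Build K
  doublePathAlg (@pscaleAl _ _ _).
HB.instance Definition _ := GRing.LSemiAlgebra_isSemiAlgebra.Build K
  doublePathAlg (@pscaleAr _ _ _).

Definition dvertex (i : vtx) : doublePathAlg := vertexP K (@adjacent Delta) i.
Definition darrow (i j : vtx) : doublePathAlg := arrowP K (@adjacent Delta) i j.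

(* the sum over the arrows a of the oriented diagram of a a^* - a^* a *)
Definition preproj_relation : doublePathAlg :=
  \sum_(i : vtx) \sum_(j : vtx | edge i j)
    (darrow i j * darrow j i - darrow j i * darrow i j).

Definition preproj := quotAlg (fun x : doublePathAlg => x = preproj_relation).
HB.instance Definition _ := GRing.PzRing.on preproj.
HB.instance Definition _ := GRing.Lmodule.on preproj.

Lemma preproj_ideal_nil (x : doublePathAlg) :
  in_ideal (fun x => x = preproj_relation) x -> forall i, x (i, [::]) = 0.
Proof.
elim=> [_ -> i|//|a b _ Ha _ Hb i|a b _ Hb i|a b _ Ha i].
- rewrite /preproj_relation.
  elim/big_ind: _ => [//|a b Ha Hb|j _]; first by rewrite /= Ha Hb addr0.
  elim/big_ind: _ => [//|a b Ha Hb|k _]; first by rewrite /= Ha Hb addr0.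
  by rewrite /= !conv_nil /path_fun /= !xpair_eqE !andbF !mulr0 addr0.
- by rewrite /= Ha Hb addr0.
- by rewrite /= conv_nil Hb mulr0.
- by rewrite /= conv_nil Ha mul0r.
Qed.

Fact preproj_nonzero : (1 : preproj) != 0.
Proof.
apply/negP; rewrite (_ : 0 = qpi _ 0); last by rewrite /qpi piE.
move=> /qpi_eqP; rewrite subr0 => /preproj_ideal_nil.
by move=> /(_ (Ordinal (rank_gt0 Delta)))/eqP; rewrite oner_eq0.
Qed.
HB.instance Definition _ :=
  GRing.PzSemiRing_isNonZero.Build preproj preproj_nonzero.
HB.instance Definition _ := GRing.LSemiModule_isLSemiAlgebra.Build K
  preproj (@qscaleAl _ _ _).
HB.instance Definition _ := GRing.LSemiAlgebra_isSemiAlgebra.Build K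
  preproj (@qscaleAr _ _ _).

Definition vertex (i : vtx) : preproj := qpi _ (dvertex i).

Lemma vertex_mul i j : vertex i * vertex j = if i == j then vertex i else 0.
Proof.
rewrite -[LHS]/(qmul _ _) -qpiM [dvertex i * _]vertexP_mul; case: eqP => //= _.
by rewrite /qpi piE.
Qed.

Variable I : {set vtx}.

Definition eI_val : preproj := 1 - \sum_(i in I) vertex i.

Lemma vertex_sum_mul j :
  (\sum_(i in I) vertex i) * vertex j = if j \in I then vertex j else 0.
Proof.
rewrite mulr_suml; case: ifPn => jI.
  rewrite (bigD1 j) //= vertex_mul eqxx big1 ?addr0 // => i /andP[_ /negPf ij].
  by rewrite vertex_mul ij.
rewrite big1 // => i iI; rewrite vertex_mul; case: eqP => // ij.
by rewrite -ij iI in jI.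
Qed.

Lemma vertex_mul_sum j :
  vertex j * (\sum_(i in I) vertex i) = if j \in I then vertex j else 0.
Proof.
rewrite mulr_sumr; case: ifPn => jI.
  rewrite (bigD1 j) //= vertex_mul eqxx big1 ?addr0 // => i /andP[_ /negPf ij].
  by rewrite vertex_mul eq_sym ij.
rewrite big1 // => i iI; rewrite vertex_mul; case: eqP => // ij.
by rewrite ij iI in jI.
Qed.

Lemma eI_idem : eI_val * eI_val = eI_val.
Proof.
rewrite /eI_val mulrBr mulr1 mulrBl mul1r; set S := \sum_(i in I) vertex i.
have -> : S * S = S.
  by rewrite {2}/S mulr_sumr; apply: eq_bigr => i iI; rewrite vertex_sum_mul iI.
by rewrite subrr subr0.
Qed.
Definition eI : idempotent preproj := Idempotent eI_idem.

Lemma cornerVertex_subproof (j : {j : vtx | j \notin I}) :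
  idem_val eI * vertex (val j) * idem_val eI == vertex (val j).
Proof.
case: j => j /= /negPf jI; rewrite /eI_val mulrBl mul1r vertex_sum_mul jI subr0.
by rewrite mulrBr mulr1 vertex_mul_sum jI subr0.
Qed.
Definition cornerVertex (j : {j : vtx | j \notin I}) : corner eI :=
  Corner (cornerVertex_subproof j).

Definition dimvec (M : fdmod eI) : {ffun {j : vtx | j \notin I} -> int} :=
  [ffun j => (\dim (limg (act M (cornerVertex j))))%:Z].

End Preprojective.

Section RestrictedRoots.
Variables (R : realType) (Delta : ADE).
Local Notation vtx := 'I_(rank Delta).

(* the space h, with basis the simple roots *)
Definition rootSpace := {ffun vtx -> R^o}.
HB.instance Definition _ := GRing.Lmodule.on rootSpace.
HB.instance Definition _ := Vector.on rootSpace.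

Definition simple_root (i : vtx) : rootSpace := [ffun j => (j == i)%:R].

(* v |-> v - (v, alpha_i) alpha_i, where (alpha_i, alpha_i) = 2 and
   (alpha_i, alpha_j) is -1 or 0 as i, j are adjacent or not *)
Definition reflection (i : vtx) (v : rootSpace) : rootSpace :=
  v - (v i *+ 2 - \sum_(j | adjacent i j) v j) *: simple_root i.

(* The root system is the orbit of the simple roots under the Weyl group. *)
Inductive is_root : rootSpace -> Prop :=
  | simple_is_root i : is_root (simple_root i)
  | reflection_is_root i v of is_root v : is_root (reflection i v).

Definition positive_root (v : rootSpace) : Prop :=
  is_root v /\ forall i, 0 <= v i.

Variable I : {set vtx}.

(* The quotient of h by the span of the alpha_i, i in I, in the coordinates
   given by its basis of the images of the other alpha_j; see lker_restr and
   limg_restr. *)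
Definition restrSpace := {ffun {j : vtx | j \notin I} -> R^o}.
HB.instance Definition _ := GRing.Lmodule.on restrSpace.
HB.instance Definition _ := Vector.on restrSpace.

Definition restr (v : rootSpace) : restrSpace := [ffun j => v (val j)].

Fact restr_linear : linear restr.
Proof. by move=> a u v; apply/ffunP => j; rewrite !ffunE. Qed.
HB.instance Definition _ :=
  GRing.isLinear.Build R rootSpace restrSpace *:%R restr restr_linear.

Lemma lker_restr : lker (linfun restr) = <<[seq simple_root i | i in I]>>%VS.
Proof.
apply/eqP; rewrite eqEsubv; apply/andP; split; last first.
  apply/span_subvP => _ /imageP[i iI ->]; rewrite memv_ker lfunE /=.
  apply/eqP/ffunP => -[j jI]; rewrite !ffunE /=.
  by case: eqP => // ji; rewrite ji iI in jI.
apply/subvP => v; rewrite memv_ker lfunE /= => /eqP v0.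
rewrite (_ : v = \sum_(i in I) v i *: simple_root i).
  by apply: rpred_sum => i iI; apply/rpredZ/memv_span/imageP; exists i.
apply/ffunP => k; rewrite sum_ffunE; have [kI|kI] := boolP (k \in I).
  rewrite (bigD1 k) //= !ffunE eqxx big1 ?addr0.
    by rewrite /GRing.scale /= mulr1.
  move=> i /andP[_ /negPf ik].
  by rewrite !ffunE eq_sym ik /GRing.scale /= mulr0.
have := congr1 (fun u : restrSpace => u (Sub k kI)) v0.
rewrite !ffunE /= => ->; rewrite big1 // => i iI.
rewrite !ffunE; case: eqP => [ki|_]; first by rewrite ki iI in kI.
by rewrite /GRing.scale /= mulr0.
Qed.

Lemma limg_restr : limg (linfun restr) = fullv.
Proof.
apply/vspaceP => w; rewrite memvf; apply/memv_imgP.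
pose v : rootSpace := [ffun i => if insub i is Some j then w j else 0].
exists v; rewrite ?memvf // lfunE /=; apply/ffunP => j.
by rewrite !ffunE /= valK.
Qed.

Definition pos_restricted_root (b : restrSpace) : Prop :=
  b != 0 /\ exists2 v, positive_root v & b = restr v.

Definition primitive_restricted_root (b : restrSpace) : Prop :=
  pos_restricted_root b /\
  forall c, pos_restricted_root c -> c != b -> forall m : int, b <> c *~ m.

(* the identification of Z^(Delta - I) with a subset of h_I *)
Definition lattice_incl (d : {ffun {j : vtx | j \notin I} -> int}) : restrSpace :=
  \sum_j restr (simple_root (val j)) *~ d j.

End RestrictedRoots.

(* Main.v *)
(* The sign in the preprojective relation is removed by rescaling the arrows
   along a 2-colouring of the diagram.  A brick over the corner algebra extends
   to a brick X over the preprojective algebra generated by, and cogenerated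
   by, its restriction: X is the state space of a minimal realisation of the
   Hankel matrix of the action of all words in the removed vertices.  This
   matrix has finite rank because the dimensions d_i(k) reached by words of
   length k satisfy d_i(k) + d_i(k+2) <= sum_{j ~ i} d_j(k+1) + const, which
   prevents growth on a Dynkin diagram.

   X is Hom-orthogonal on both sides to the simples S_i, i in I, so that X and
   these S_i form a semibrick.  As long as a semibrick has a nonsimple member,
   some simple S_i embeds in that member, no member has S_i as a quotient, and
   the reflection functor at i gives a new semibrick; a height function shows
   that this stops.  Hence the dimension vectors of X and the alpha_i, i in I,
   are the images of distinct simple roots under one Weyl group element w.  In
   particular dim X is a root, and it extends the alpha_i to part of a basis of
   the root lattice, so its coordinates outside I have greatest common
   divisor 1. *)
From HB Require Import structures.
Require Import Defs.
From mathcomp Require Import all_boot all_order all_algebra.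
From mathcomp Require Import ring lra zify.
From mathcomp Require Import boolp reals complex.

Set Implicit Arguments.
Unset Strict Implicit.
Unset Printing Implicit Defensive.
Import Order.TTheory GRing.Theory Num.Theory.
Local Open Scope ring_scope.

(** * The root lattice *)

(** The shape of the diagram enters only through its 2-colouring and one integral vector [x] with
    [x i > 0] and [cart x i > 0] at every vertex, a multiple of the half sum of the positive roots.
    Pairing with [x] gives the semidefiniteness of the form, the existence of socles, the bound on
    Hankel ranks and the height. The representation X is the intermediate extension of the brick,
    that is, the image of the canonical map from the induced to the coinduced module. The obstacle
    is its finite dimension; this is why it is built from a matrix whose rank can be bounded. The
    height of a word [w] is [form (w x) x]. Reflecting at [i] lowers it provided that [w alpha_i] is
    a nonnegative vector. Knowing this for the members of the semibrick would not suffice, so the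
    induction follows the dimension vectors of all their subrepresentations, among which is the
    simple S_i in the socle of a member. *)

Section Lattice.
Variables (V : finType) (adj : rel V).
Hypotheses (adj_sym : symmetric adj) (adj_irr : irreflexive adj).
Implicit Types (u v : {ffun V -> int}) (i j : V) (ws : seq V).

Definition alpha i : {ffun V -> int} := [ffun j => (j == i)%:R].
Definition cart v i : int := v i *+ 2 - \sum_(j | adj i j) v j.
Definition refl i v : {ffun V -> int} := v - alpha i *~ cart v i.
(** The head of the word acts last, so [rcons] records a further reflection of the representations:
    [wact ws] carries the current dimension vectors back to the initial ones. *)
Definition wact ws v := foldr refl v ws.
Definition form u v : int := \sum_i u i * cart v i.

Lemma cartD u v i : cart (u + v) i = cart u i + cart v i.
Proof.
rewrite /cart ffunE; under eq_bigr do rewrite ffunE.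
by rewrite big_split /= mulrnDl opprD addrACA.
Qed.

Lemma cartN v i : cart (- v) i = - cart v i.
Proof.
rewrite /cart ffunE; under eq_bigr do rewrite ffunE.
by rewrite sumrN mulNrn -opprD.
Qed.

Lemma refl_is_additive i : {morph refl i : u v / u - v}.
Proof.
move=> u v; rewrite /refl cartD cartN mulrzBr.
by rewrite !opprD !opprK addrACA.
Qed.

Lemma wact_is_additive ws : {morph wact ws : u v / u - v}.
Proof. by elim: ws => // i ws IH u v /=; rewrite IH refl_is_additive. Qed.

HB.instance Definition _ ws := GRing.isZmodMorphism.Build
  {ffun V -> int} {ffun V -> int} (wact ws) (@wact_is_additive ws).

Lemma ffunMz v (m : int) j : (v *~ m) j = v j * m.
Proof. by rewrite ffunMzE mulrzz. Qed.

Lemma reflE i v j : refl i v j = v j - (j == i)%:R * cart v i.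
Proof. by rewrite /refl !ffunE ffunMz ffunE. Qed.

Lemma cart_refl i v : cart (refl i v) i = - cart v i.
Proof.
rewrite /cart reflE eqxx mul1r (eq_bigr v) => [|k ik]; last first.
  by rewrite reflE; case: eqP ik => [->|_ _]; rewrite ?adj_irr ?mul0r ?subr0.
by rewrite /cart !mulr2n; ring.
Qed.

Lemma reflK i : involutive (refl i).
Proof.
by move=> v; apply/ffunP => j; rewrite !reflE cart_refl mulrN opprK subrK.
Qed.

Lemma wactK ws : cancel (wact ws) (wact (rev ws)).
Proof.
elim: ws => // i ws IH v; rewrite rev_cons /wact foldr_rcons /= -/(wact _ _).
by rewrite reflK; exact: IH.
Qed.

Lemma formDl u v t : form (u + v) t = form u t + form v t.
Proof. by rewrite -big_split; apply: eq_bigr => i _; rewrite ffunE mulrDl. Qed.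

Lemma formC u v : form u v = form v u.
Proof.
rewrite /form /cart.
under eq_bigr do rewrite mulrBr mulr_sumr.
under [RHS]eq_bigr do rewrite mulrBr mulr_sumr.
rewrite !sumrB; congr (_ - _); first by apply: eq_bigr => i _; lia.
rewrite (exchange_big_dep predT) //=; apply: eq_bigr => j _.
by apply: eq_big => [i|i _]; [rewrite adj_sym|rewrite mulrC].
Qed.

Lemma formBl u v t : form (u - v) t = form u t - form v t.
Proof.
rewrite formDl; congr (_ + _); rewrite -sumrN.
by apply: eq_bigr => i _; rewrite ffunE mulNr.
Qed.

Lemma formMzl u (m : int) t : form (u *~ m) t = m * form u t.
Proof. by rewrite mulr_sumr; apply: eq_bigr => i _;
  rewrite ffunMz mulrAC mulrC. Qed.

Lemma form_alpha i v : form (alpha i) v = cart v i.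
Proof.
rewrite /form (bigD1 i) //= ffunE eqxx mul1r big1 ?addr0 // => j /negPf ji.
by rewrite ffunE ji mul0r.
Qed.

Lemma form_refl i v : form (refl i v) (refl i v) = form v v.
Proof.
rewrite formBl formMzl form_alpha cart_refl formC formBl formMzl form_alpha.
by rewrite mulrN opprK subrK.
Qed.

Lemma form_act ws v : form (wact ws v) (wact ws v) = form v v.
Proof. by elim: ws => //= i ws IH; rewrite form_refl. Qed.

Variable x : {ffun V -> int}.
Hypotheses (x_gt0 : forall i, 0 < x i) (x_dom : forall i, 0 < cart x i).

(* For adjacent i, j the square [(x_j v_i - x_i v_j)^2 / (x_i x_j)] is
   nonnegative; sum over the edges. *)
Lemma form_ge0 v : 0 <= form v v.
Proof.
pose y i : rat := (x i)%:~R; pose z i : rat := (v i)%:~R.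
have y0 i : 0 < y i by rewrite ltr0z.
have yc i : \sum_(j | adj i j) y j <= y i *+ 2.
  have := x_dom i; rewrite subr_gt0 => /ltW.
  by rewrite -(ler_int rat) rmorph_sum rmorphMn.
rewrite -(ler_int rat) rmorph_sum /=.
under eq_bigr do rewrite rmorphM rmorphB /= rmorphMn rmorph_sum /= mulrBr.
rewrite sumrB subr_ge0 -(ler_pMn2r (n := 2)) //.
have H i j : z i * z j *+ 2 <= y j / y i * z i ^+ 2 + y i / y j * z j ^+ 2.
  rewrite -subr_ge0.
  have -> : y j / y i * z i ^+ 2 + y i / y j * z j ^+ 2 - z i * z j *+ 2 =
     (y j * z i - y i * z j) ^+ 2 / (y i * y j).
    by field; rewrite (gt_eqF (y0 i)) (gt_eqF (y0 j)). 
  by rewrite divr_ge0 ?sqr_ge0 // ltW // mulr_gt0.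
apply: (@le_trans _ _ (\sum_i \sum_(j | adj i j)
   (y j / y i * z i ^+ 2 + y i / y j * z j ^+ 2))).
  rewrite -sumrMnl; apply: ler_sum => i _.
  by rewrite mulr_sumr -sumrMnl; apply: ler_sum => j _; exact: H.
under eq_bigr do rewrite big_split /=.
rewrite big_split /= [X in _ + X](exchange_big_dep predT) //= -big_split /=.
rewrite -sumrMnl; apply: ler_sum => i _.
rewrite [X in _ + X](eq_bigl (adj i)); last by move=> j; rewrite adj_sym.
rewrite -mulr2n ler_pMn2r // -!mulr_suml -/(z i).
have -> : z i * (z i *+ 2) = y i *+ 2 / y i * z i ^+ 2.
  by field; rewrite (gt_eqF (y0 i)).
by rewrite ler_wpM2r ?sqr_ge0 // ler_wpM2r ?invr_ge0 // ltW.
Qed.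

(** Expand the nonnegative square of [w x + x], using [(w x, w x) = (x, x)]. *)
Lemma height_ge ws : - form x x <= form (wact ws x) x.
Proof.
have := form_ge0 (wact ws x + x).
rewrite formDl !(formC _ (_ + _)) !formDl form_act (formC x (wact _ _)) => h;
  lra.
Qed.

Lemma form_dom_gt0 v : (forall i, 0 <= v i) -> v != 0 -> 0 < form v x.
Proof.
move=> v0 vn; rewrite lt_neqAle sumr_ge0 ?andbT; last first.
  by move=> i _; rewrite mulr_ge0 // ltW.
apply: contra vn; rewrite eq_sym psumr_eq0 => [|i _]; last first.
  by rewrite mulr_ge0 // ltW.
move/allP => z; apply/eqP/ffunP => i; rewrite ffunE.
have := z i; rewrite mem_index_enum => /(_ isT) /=.
by rewrite mulf_eq0 (gt_eqF (x_dom i)) orbF => /eqP.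
Qed.

(** With [s_i] the reflection at [i], [w s_i x = w x - (x, alpha_i) w alpha_i]. Both [(x, alpha_i)]
    and [(w alpha_i, x)] are positive, the latter because [w alpha_i] is nonnegative, and nonzero as
    [w] is invertible. *)
Lemma form_dom_refl ws i : (forall j, 0 <= wact ws (alpha i) j) ->
  form (wact (rcons ws i) x) x < form (wact ws x) x.
Proof.
move=> w0; rewrite /wact foldr_rcons -/(wact _ _) [refl i x]/(x - _).
rewrite raddfB /= raddfMz /= formBl formMzl.
rewrite gtrDl oppr_lt0 mulr_gt0 // form_dom_gt0 //.
apply/eqP => /(congr1 (wact (rev ws))); rewrite wactK raddf0.
by move/(congr1 (fun v : {ffun V -> int} => v i)); rewrite !ffunE eqxx.
Qed.

End Lattice.

Lemma rank_sumsmx_le (K : fieldType) (I : finType) (P : pred I) n (W : I ->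
  'M[K]_n) :
  (\rank (\sum_(i | P i) W i)%MS <= \sum_(i | P i) \rank (W i))%N.
Proof.
elim/big_rec2: _ => [|i r N _ IH]; first by rewrite mxrank0.
by apply: leq_trans (mxrank_adds_leqif _ _) _; rewrite leq_add2l.
Qed.

(** * Representations and reflection functors *)

Section Representations.
Variables (K : fieldType) (V : finType) (adj : rel V).

(* Matrices act on row vectors.  All arrows are collected in the single matrix
   [rarr].  The vertex idempotents need not sum to 1: their images make up the
   representation, and the rest of the ambient space plays no role. *)
Record rep := Rep {
  rsize : nat;
  rvert : V -> 'M[K]_rsize;
  rarr : 'M[K]_rsize
}.
Implicit Types (X Y : rep).

Definition runit X : 'M[K]_(rsize X) := \sum_i rvert X i.

Record is_rep X : Prop := IsRep {
  rvertM : forall i j,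
    rvert X i *m rvert X j = if i == j then rvert X i else 0;
  rarr_unit : runit X *m rarr X *m runit X = rarr X;
  rarr_adj : forall i j, ~~ adj i j -> rvert X i *m rarr X *m rvert X j = 0;
  rarr_rel : forall i, rvert X i *m rarr X *m rarr X *m rvert X i = 0
}.

Definition rdim X : {ffun V -> int} := [ffun i => (\rank (rvert X i))%:Z].

Definition rhom X Y (f : 'M[K]_(rsize X, rsize Y)) : Prop :=
  [/\ forall i, rvert X i *m f = f *m rvert Y i,
      rarr X *m f = f *m rarr Y & runit X *m f = f].

Definition rbrick X : Prop :=
  runit X != 0 /\ forall f : 'M_(rsize X), rhom f -> exists c, f = c *: runit X.

Definition rorth X Y : Prop := forall f : 'M_(rsize X, rsize Y), rhom f -> f =
  0.

Record is_subrep X (Y : V -> 'M[K]_(rsize X)) : Prop := IsSubrep {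
  subrep_vert : forall i, Y i *m rvert X i = Y i;
  subrep_arr : forall i j, (Y i *m rarr X *m rvert X j <= Y j)%MS
}.

Definition sdim X (Y : V -> 'M[K]_(rsize X)) : {ffun V -> int} :=
  [ffun i => (\rank (Y i))%:Z].

(* [v] spans a subrepresentation isomorphic to the simple at [i]. *)
Definition in_socle X i (v : 'rV[K]_(rsize X)) : Prop :=
  [/\ v != 0, v *m rvert X i = v & v *m rarr X = 0].

(* The simple at [i] is not a quotient of [X]. *)
Definition no_top X i : Prop := (rvert X i <= rarr X *m rvert X i)%MS.

Arguments rhom : clear implicits.
Arguments rorth : clear implicits.
Arguments is_subrep : clear implicits.
Arguments sdim : clear implicits.
Arguments in_socle : clear implicits.

Section RepTheory.
Variable X : rep.
Hypothesis rX : is_rep X.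

Lemma runitl i : runit X *m rvert X i = rvert X i.
Proof.
rewrite mulmx_suml (bigD1 i) //= (rvertM rX) eqxx big1 ?addr0 // => j ji.
by rewrite (rvertM rX) (negPf ji).
Qed.

Lemma runitr i : rvert X i *m runit X = rvert X i.
Proof.
rewrite mulmx_sumr (bigD1 i) //= (rvertM rX) eqxx big1 ?addr0 // => j ji.
by rewrite (rvertM rX) eq_sym (negPf ji).
Qed.

Lemma runitK : runit X *m runit X = runit X.
Proof. by rewrite {2}/runit mulmx_sumr; apply: eq_bigr => i _;
  exact: runitl. Qed.

Lemma rarrEl : runit X *m rarr X = rarr X.
Proof. by rewrite -(rarr_unit rX) !mulmxA runitK. Qed.

Lemma rarrEr : rarr X *m runit X = rarr X.
Proof. by rewrite -(rarr_unit rX) -!mulmxA runitK. Qed.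

Definition nbr i : 'M[K]_(rsize X) := \sum_(j | adj i j) rvert X j.

Lemma nbr_arrl i : rvert X i *m rarr X *m nbr i = rvert X i *m rarr X.
Proof.
rewrite -[in RHS]rarrEr /runit mulmxA [RHS]mulmx_sumr [LHS]mulmx_sumr.
rewrite (bigID (adj i) predT) /= [X in _ = _ + X]big1 ?addr0 //.
by move=> j /(rarr_adj rX).
Qed.

Hypothesis adj_sym : symmetric adj.

Lemma nbr_arrr i : nbr i *m rarr X *m rvert X i = rarr X *m rvert X i.
Proof.
rewrite -[in RHS]rarrEl /runit !mulmx_suml.
rewrite (bigID (adj i) predT) /= [X in _ = _ + X]big1 ?addr0 //.
by move=> j; rewrite adj_sym => /(rarr_adj rX).
Qed.

Lemma nbrMr i j : nbr i *m rvert X j = if adj i j then rvert X j else 0.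
Proof.
rewrite mulmx_suml; case: ifP => ij.
  rewrite (bigD1 j) //= (rvertM rX) eqxx big1 ?addr0 // => k /andP[_ kj].
  by rewrite (rvertM rX) (negPf kj).
by rewrite big1 // => k ik; rewrite (rvertM rX); case: eqP => // jk;
  rewrite -jk ik in ij.
Qed.

Lemma nbrK i : nbr i *m nbr i = nbr i.
Proof.
rewrite {2}/nbr mulmx_sumr; apply: eq_bigr => j ij.
by rewrite nbrMr ij.
Qed.

(* In a minimal nonzero subrepresentation [Y] without socle at any vertex the
   maps [Y_i -> sum_j Y_j -> Y_i] compose to zero, the first one is injective
   and the second one surjective, out_secK [dim Y] is antidominant. *)
Variable x : {ffun V -> int}.
Hypotheses (x_gt0 : forall i, 0 < x i) (x_dom : forall i, 0 < cart adj x i).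

Lemma exists_socle_sub (Y : V -> 'M[K]_(rsize X)) : is_subrep X Y ->
  (exists i, Y i != 0) -> exists i v, in_socle X i v.
Proof.
move=> sY nY; apply: contrapT => nsoc.
have inj i (v : 'rV_(rsize X)) : v *m rvert X i = v -> v *m rarr X = 0 -> v = 0.
  move=> vi vb; apply/eqP; case: (eqVneq v 0) => // v0; case: nsoc.
  by exists i, v.
have [m] := ubnP (\sum_i \rank (Y i))%N.
elim: m Y sY nY => // m IH Y sY [i0 Yi0] le_m.
pose S i := (\sum_(j | adj i j) Y j)%MS.
have YS i j : adj i j -> (Y j <= S i)%MS.
  by move=> ij; rewrite /S (sumsmx_sup j).
pose Z i := S i *m rarr X *m rvert X i.
have ZY i : (Z i <= Y i)%MS.
  rewrite /Z /S -mulmxA sumsmxMr; apply/sumsmx_subP => j ij.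
  by rewrite mulmxA; exact: subrep_arr.
have sZ : is_subrep X Z.
  split=> [i|i j]; first by rewrite /Z -!mulmxA (rvertM rX) eqxx.
  have [ij|ij] := boolP (adj i j); last first.
    by rewrite /Z -!mulmxA (mulmxA (rvert X i)) (rarr_adj rX ij) !mulmx0 sub0mx.
  apply: submxMr; apply: submxMr; apply: submx_trans (ZY i) _.
  by apply: YS; rewrite adj_sym.
(* If all [Z i] vanished, a nonzero row of [Y i0] would be killed by every arrow and so lie in the
   socle. *)
have nZ : exists i, Z i != 0.
  have [k rk] : exists k, row k (Y i0) != 0.
    apply: contrapT => r0; case/eqP: Yi0; apply/row_matrixP => k.
    rewrite row0; apply/eqP; case: (eqVneq (row k (Y i0)) 0) => // h.
    by case: r0; exists k.
  apply: contrapT => Z0; case/eqP: rk; apply: (inj i0).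
    by rewrite -row_mul (subrep_vert sY).
  rewrite -rarrEr mulmxA /runit mulmx_sumr big1 // => j _.
  have [ij|ij] := boolP (adj i0 j); last first.
    by rewrite -(subrep_vert sY) row_mul -!mulmxA (mulmxA (rvert X i0))
      (rarr_adj rX ij) mulmx0.
  apply/eqP; rewrite -submx0; case: (eqVneq (Z j) 0) => [<-|h]; last first.
    by case: Z0; exists j.
  apply: submxMr; apply: submxMr; apply: submx_trans (row_sub _ _) _.
  by apply: YS; rewrite adj_sym.
have rZ i : (\rank (Z i) <= \rank (Y i))%N by exact: mxrankS.
(* Either [Z] is a smaller nonzero subrepresentation and induction applies, or the ranks agree
   everywhere, which is the surjectivity of the maps into each vertex. *)
have [lt|ge] := ltnP (\sum_i \rank (Z i)) (\sum_i \rank (Y i)).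
  by apply: (IH Z) => //; apply: leq_trans lt _; rewrite -ltnS.
have eq_r i : \rank (Z i) = \rank (Y i).
  apply/eqP; rewrite eqn_leq rZ /= leqNgt; apply/negP => lt.
  move: ge; rewrite leqNgt => /negP; apply.
  rewrite (bigD1 i) //= [X in (_ < X)%N](bigD1 i) //= -addSn.
  by apply: leq_add => //; apply: leq_sum.
pose y := sdim X Y.
have y0 i : 0 <= y i by rewrite ffunE.
have : 0 < form adj y x.
  apply: form_dom_gt0 => //; apply/eqP => yz; case/eqP: Yi0.
  have := congr1 (fun v : {ffun V -> int} => v i0) yz.
  by rewrite !ffunE => /eqP; rewrite eqz_nat mxrank_eq0 => /eqP.
rewrite formC // ltNge => /negP; apply; apply: sumr_le0 => i _.
rewrite mulr_ge0_le0 ?(ltW (x_gt0 i)) //.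
rewrite /cart subr_le0 (eq_bigr (fun j => (\rank (Y j))%:Z)); last first.
  by move=> j _; rewrite ffunE.
rewrite -(big_morph Posz PoszD (erefl _)) ffunE mulr2n -PoszD lez_nat.
apply: leq_trans (rank_sumsmx_le _ Y); rewrite -/(S i).
(* The map from [S i] to [Z i] has rank [\rank (Y i)], and its kernel contains [Y i *m rarr X] by
   the relation at [i]. That image has the rank of [Y i] as well, since there is no socle, so
   [2 * \rank (Y i) <= \rank (S i)]. *)
rewrite -(mxrank_mul_ker (S i) (rarr X *m rvert X i)) mulmxA -/(Z i) eq_r.
rewrite leq_add2l.
have -> : \rank (Y i) = \rank (Y i *m rarr X).
  rewrite -[LHS](mxrank_mul_ker _ (rarr X)) -[LHS]/(_ + _)%N.
  suff -> : (Y i :&: kermx (rarr X))%MS = 0 by rewrite mxrank0 addn0.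
  apply/row_matrixP => k; rewrite row0; apply: (inj i).
    have /submxP[D ->] : (row k (Y i :&: kermx (rarr X))%MS <= Y i)%MS.
      by apply: submx_trans (row_sub _ _) (capmxSl _ _).
    by rewrite -mulmxA (subrep_vert sY).
  apply/sub_kermxP; exact: submx_trans (row_sub _ _) (capmxSr _ _).
apply: mxrankS; rewrite sub_capmx; apply/andP; split.
  rewrite -(subrep_vert sY) -mulmxA -nbr_arrl /nbr mulmxA mulmx_sumr.
  apply: summx_sub => j ij; apply: submx_trans (YS i j ij).
  by rewrite mulmxA (subrep_vert sY); exact: subrep_arr.
apply/sub_kermxP.
have := rarr_rel rX i; rewrite -!mulmxA => E.
by rewrite -(subrep_vert sY) -!mulmxA E mulmx0.
Qed.

Lemma exists_socle : runit X != 0 -> exists i v, in_socle X i v.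
Proof.
move=> U0; apply: (exists_socle_sub (Y := rvert X)).
  split=> [i|i j]; first by rewrite (rvertM rX) eqxx.
  by rewrite submxMl.
apply: contrapT => e0; case/eqP: U0; apply: big1 => i _.
by case: (eqVneq (rvert X i) 0) => // h; case: e0; exists i.
Qed.

End RepTheory.

(** Right multiplication by [A] sends [A + B] to [A], and the part of the row space of [A + B] that
    it kills contains that of [B]. *)
Lemma idem_rankD n (A B : 'M[K]_n) : A *m A = A -> B *m B = B ->
  A *m B = 0 -> B *m A = 0 -> \rank (A + B)%R = (\rank A + \rank B)%N.
Proof.
move=> AA BB AB BA; apply/eqP; rewrite eqn_leq mxrank_add /=.
rewrite -(mxrank_mul_ker (A + B)%R A) mulmxDl AA BA addr0 leq_add2l mxrankS //.
rewrite sub_capmx; apply/andP; split; last exact/sub_kermxP.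
by apply/submxP; exists B; rewrite mulmxDr BA BB add0r.
Qed.

Lemma idem_rank_sum n (P : pred V) (e : V -> 'M[K]_n) :
  (forall i j, e i *m e j = if i == j then e i else 0) ->
  \rank (\sum_(i | P i) e i)%R = (\sum_(i | P i) \rank (e i))%N.
Proof.
move=> eM; rewrite -[\sum_(i | P i) e i]big_filter -[RHS]big_filter.
have: uniq [seq i <- index_enum V | P i] by rewrite filter_uniq
  ?index_enum_uniq.
elim: [seq i <- _ | _] => [|i r IH]; first by rewrite !big_nil mxrank0.
rewrite !big_cons /= => /andP[ir ur].
rewrite -(IH ur).
have El j : e j *m (\sum_(k <- r) e k) = if j \in r then e j else 0.
  elim: r ur {IH ir} => [|k r IH]; first by rewrite big_nil mulmx0.
  rewrite big_cons mulmxDr eM inE => /= /andP[/negPf kr ur].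
  by rewrite (IH ur); case: eqP => [->|_]; rewrite ?kr ?addr0 ?add0r.
have Er j : (\sum_(k <- r) e k) *m e j = if j \in r then e j else 0.
  elim: r ur {IH ir El} => [|k r IH]; first by rewrite big_nil mul0mx.
  rewrite big_cons mulmxDl eM inE eq_sym => /= /andP[/negPf kr ur].
  by rewrite (IH ur); case: eqP => [->|_]; rewrite ?kr ?addr0 ?add0r.
apply: idem_rankD; rewrite ?eM ?eqxx ?El ?Er ?(negPf ir) //.
rewrite big_seq mulmx_sumr; apply: eq_bigr => j jr.
by rewrite -big_seq Er jr.
Qed.

Lemma runit_sub (X : rep) i :
  runit X - rvert X i = \sum_(j | j != i) rvert X j.
Proof. by rewrite /runit (bigD1 i) //= addrAC subrr add0r. Qed.

(** * The reflection functor at a vertex without top *)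

Section Reflection.
Variables (X : rep) (i : V).
Hypotheses (rX : is_rep X) (adj_sym : symmetric adj) (adj_irr : irreflexive
  adj).
Hypothesis topX : no_top X i.

Let e := rvert X.
Let b := rarr X.
Let q := nbr X i.
Let o := b *m e i.
Let U' := runit X - e i.
(** [no_top] makes [o] surjective onto the space at [i], and [out_sec] is a section of it; the
    factor [q] makes it land in the neighbouring spaces. Then [out_ker] projects these onto the
    kernel of [o] along the section. *)
Definition out_sec : 'M[K]_(rsize X) := e i *m pinvmx o *m q.
Definition out_ker : 'M[K]_(rsize X) := q - o *m out_sec.
Let s := out_sec.
Let p := out_ker.

(* The space at [i] is replaced by the kernel of [o], the total map into [i],
   realised in a second copy of the ambient space as the image of the
   projection [p]. *)
Definition refl_rep : rep := Rep
  (fun j => if j == i then block_mx 0 0 0 p else block_mx (e j) 0 0 0)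
  (block_mx (U' *m b *m U') (o *m (e i *m b)) p 0).

Lemma nbr_out : q *m o = o. Proof. by rewrite /o mulmxA nbr_arrr. Qed.
Lemma out_vert : o *m e i = o. Proof. by rewrite /o -mulmxA (rvertM rX) eqxx.
  Qed.
Lemma out_sec_nbr : s *m q = s. Proof. by rewrite /s /out_sec -mulmxA nbrK. Qed.
Lemma vert_out_sec : e i *m s = s.
Proof. by rewrite /s /out_sec !mulmxA (rvertM rX) eqxx. Qed.
Lemma out_secK : s *m o = e i.
Proof. by rewrite /s /out_sec -mulmxA nbr_out mulmxKpV. Qed.
Lemma out_ker_out : p *m o = 0.
Proof. by rewrite mulmxBl -mulmxA out_secK nbr_out out_vert subrr. Qed.
Lemma out_ker_nbr : p *m q = p.
Proof. by rewrite mulmxBl -mulmxA out_sec_nbr nbrK. Qed.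
Lemma out_kerK : p *m p = p.
Proof. by rewrite {2}/p /out_ker mulmxBr mulmxA out_ker_out mul0mx subr0
  out_ker_nbr. Qed.
Lemma nbr_vert : q *m e i = 0.
Proof. by rewrite nbrMr // adj_irr. Qed.
Lemma out_ker_vert j : p *m e j = if adj i j then p *m e j else 0.
Proof. by case: ifPn => // /negPf ij;
  rewrite -out_ker_nbr -mulmxA nbrMr // ij mulmx0. Qed.
Lemma vert_arr_nbr : e i *m b *m q = e i *m b.
Proof. by rewrite nbr_arrl. Qed.
Lemma vert_arr_out : e i *m b *m o = 0.
Proof. by rewrite /o mulmxA (rarr_rel rX). Qed.
Lemma vert_arr_ker : e i *m b *m p = e i *m b.
Proof. by rewrite mulmxBr vert_arr_nbr mulmxA vert_arr_out mul0mx subr0. Qed.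
Lemma vert_arr_vert : e i *m b *m e i = 0.
Proof. by rewrite (rarr_adj rX) ?adj_irr. Qed.
Lemma unit_sub_vert j : U' *m e j = if j == i then 0 else e j.
Proof.
rewrite mulmxBl runitl // (rvertM rX) eq_sym.
by case: eqP => [->|]; rewrite ?subrr ?subr0.
Qed.
Lemma vert_unit_sub j : e j *m U' = if j == i then 0 else e j.
Proof.
rewrite mulmxBr runitr // (rvertM rX).
by case: eqP => [->|]; rewrite ?subrr ?subr0.
Qed.
Lemma unit_subK : U' *m U' = U'.
Proof. by rewrite {2}/U' mulmxBr unit_sub_vert eqxx subr0 mulmxBl runitK //
  runitr. Qed.
Lemma unit_sub_out : U' *m o = o.
Proof. by rewrite mulmxBl /o !mulmxA rarrEl // vert_arr_vert subr0. Qed.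
Lemma nbr_unit_sub : q *m U' = q.
Proof.
by rewrite mulmxBr nbr_vert subr0 mulmx_suml; apply: eq_bigr => j _;
  rewrite runitr.
Qed.
Lemma out_ker_unit_sub : p *m U' = p. Proof. by rewrite -out_ker_nbr -mulmxA
  nbr_unit_sub. Qed.
Lemma vert_arr_unit_sub : e i *m b *m U' = e i *m b. Proof. by rewrite
  -vert_arr_nbr -mulmxA nbr_unit_sub. Qed.

Lemma runit_refl : runit refl_rep = block_mx U' 0 0 p.
Proof.
rewrite /runit (bigD1 i) //= eqxx (eq_bigr (fun j => block_mx (e j) 0 0 0)).
  rewrite (_ : \sum_(j | j != i) _ =
     block_mx (\sum_(j | j != i) e j) 0 0 (0 : 'M_(rsize X))).
    rewrite add_block_mx !add0r !addr0; congr block_mx.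
    by rewrite /U' runit_sub.
  elim/big_rec2: _ => [|j A B _ ->]; first by rewrite block_mx0.
  by rewrite add_block_mx !addr0.
by move=> j /negPf->.
Qed.

Lemma is_rep_refl : is_rep refl_rep.
Proof.
split.
- move=> j k /=; have [->|ji] := eqVneq j i.
    rewrite eq_sym; case: eqP => _;
      rewrite mulmx_block !mulmx0 !mul0mx ?addr0 ?add0r.
      by rewrite out_kerK.
    by rewrite block_mx0.
  have [->|ki] := eqVneq k i.
    by rewrite (negPf ji) mulmx_block !mulmx0 !mul0mx !addr0 block_mx0.
  rewrite mulmx_block !mulmx0 !mul0mx !addr0 (rvertM rX); case: eqP => // _.
  by rewrite block_mx0.
- rewrite runit_refl /= !mulmx_block !mul0mx !mulmx0 !addr0 !add0r !mul0mx.
  congr block_mx; [|by rewrite (mulmxA U') unit_sub_out -[LHS]mulmxA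
    vert_arr_ker|by rewrite out_kerK out_ker_unit_sub].
  by rewrite !mulmxA unit_subK -!mulmxA unit_subK.
- move=> j k jk /=; have [ji|ji] := eqVneq j i; have [ki|ki] := eqVneq k i.
  + by rewrite !mulmx_block !(mul0mx, mulmx0, addr0) block_mx0.
  + rewrite !mulmx_block !(mul0mx, mulmx0, addr0, add0r) out_kerK out_ker_vert
    -ji (negPf jk).
    by rewrite block_mx0.
  + rewrite !mulmx_block !(mul0mx, mulmx0, addr0, add0r) !mulmxA.
    by rewrite (_ : e j *m b *m e i = 0) ?mul0mx ?block_mx0 // -ki (rarr_adj rX
      jk).
  + rewrite !mulmx_block !(mul0mx, mulmx0, addr0, add0r) !mulmxA vert_unit_sub
    (negPf ji).
    by rewrite -!mulmxA unit_sub_vert (negPf ki) mulmxA (rarr_adj rX jk)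
      block_mx0.
- move=> j /=; case: eqP => [ji|/eqP/negPf ji].
    rewrite !mulmx_block !(mul0mx, mulmx0, addr0, add0r).
    by rewrite out_kerK (mulmxA p) out_ker_out !mul0mx block_mx0.
  rewrite !mulmx_block !(mul0mx, mulmx0, addr0, add0r).
  have eU'j : e j *m U' = e j by rewrite vert_unit_sub ji.
  have U'ej : U' *m e j = e j by rewrite unit_sub_vert ji.
  (* The new detour through [i] is [o *m (e i *m b)] followed by [p]. As [e i *m b] already lands in
     the kernel of [o], the factor [p] changes nothing and the two sums add up to the old relation
     at [j]. *)
  rewrite (_ : e j *m (U' *m b *m U') *m (U' *m b *m U') = e j *m b *m U' *m b
    *m U').
    rewrite (_ : e j *m (o *m (e i *m b)) *m p = e j *m b *m e i *m b *m U').
      rewrite -!mulmxDl -mulmxDr subrK -(mulmxA _ U') U'ej.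
      by rewrite -(mulmxA (e j)) rarrEr // (rarr_rel rX) block_mx0.
    by rewrite /o -2!mulmxA vert_arr_ker -[in LHS]vert_arr_unit_sub !mulmxA
      -(mulmxA _ (e i) (e i))
      (rvertM rX) eqxx.
  by rewrite !mulmxA eU'j -(mulmxA _ U' U') unit_subK.
Qed.

(** The idempotent [q] is the sum of the orthogonal idempotents [p] and [o *m s], and [s *m o = e i]
    forces the latter to have the rank of [e i]. *)
Lemma rank_out_ker :
  (\rank p + \rank (e i) = \sum_(j | adj i j) \rank (e j))%N.
Proof.
have oss : \rank (o *m s) = \rank (e i).
  apply/eqP; rewrite eqn_leq; apply/andP; split.
    by rewrite -vert_out_sec mulmxA;
      apply: leq_trans (mxrankM_maxl _ _) (mxrankM_maxr _ _).
  rewrite (_ : e i = s *m (o *m s) *m o); last first.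
    by rewrite mulmxA out_secK -mulmxA out_secK (rvertM rX) eqxx.
  by apply: leq_trans (mxrankM_maxl _ _) (mxrankM_maxr _ _).
have osK : o *m s *m (o *m s) = o *m s.
  by rewrite mulmxA -(mulmxA o) out_secK out_vert.
rewrite -idem_rank_sum -/(nbr X i) -/q; last exact: rvertM.
have -> : q = p + o *m s by rewrite /p /out_ker subrK.
rewrite idem_rankD ?oss //; first exact: out_kerK.
  by rewrite mulmxA out_ker_out mul0mx.
by rewrite mulmxBr osK -mulmxA out_sec_nbr subrr.
Qed.

Lemma rdim_refl : rdim refl_rep = refl adj i (rdim X).
Proof.
apply/ffunP => j; rewrite reflE !ffunE /=; case: eqP => [->|_].
  rewrite rank_diag_block_mx mxrank0 add0n mul1r /cart ffunE.
  rewrite (eq_bigr (fun j => (\rank (e j))%:Z)) => [|k _];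
    last by rewrite ffunE.
  rewrite -(big_morph Posz PoszD (erefl _)) -rank_out_ker PoszD mulr2n; ring.
by rewrite rank_diag_block_mx mxrank0 addn0 mul0r subr0.
Qed.

(* [Y] need not be the reflection of a subrepresentation of [X]; the error term
   is a nonnegative multiple of [alpha i], which the height argument tolerates. *)
Lemma refl_subrep (Y : V -> 'M[K]_(rsize refl_rep)) : is_subrep refl_rep Y ->
  exists Z, is_subrep X Z /\ exists m : nat,
    refl adj i (sdim refl_rep Y) = sdim X Z + alpha i *+ m.
Proof.
move=> sY.
pose L : 'M[K]_(rsize X + rsize X, rsize X) := col_mx 1%:M 0.
pose R : 'M[K]_(rsize X + rsize X, rsize X) := col_mx 0 1%:M.
pose W j : 'M[K]_(rsize X) := <<(Y j : 'M_(rsize X + rsize X)) *m L>>%MS.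
pose S := (\sum_(j | adj i j) W j)%MS.
(* Away from [i], keep the projection of [Y] to the first copy; at [i], take only what is reached
   from the neighbours, the least choice closed under the arrows. *)
pose Z j : 'M[K]_(rsize X) := if j == i then S *m o else W j.
pose T : 'M[K]_(rsize X + rsize X, rsize X) := (Y i : 'M_(rsize X + rsize X))
  *m R.
have ij j : adj i j -> j != i by apply: contraTneq => ->; rewrite adj_irr.
have Yj j : j != i -> Y j = Y j *m (L *m row_mx (e j) 0).
  move=> /negPf ji; rewrite -[LHS](subrep_vert sY) /= ji; congr (_ *m _).
  by rewrite mul_col_row !mul1mx !mul0mx.
have Yi : Y i = T *m row_mx 0 p.
  rewrite -[LHS](subrep_vert sY) /= eqxx /T -mulmxA; congr (_ *m _).
  by rewrite mul_col_row !mul1mx !mul0mx.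
have YLe j : j != i -> (Y j : 'M_(rsize X + rsize X)) *m L *m e j = Y j *m L.
  move=> ji; rewrite [in RHS](Yj j ji) -!mulmxA mul_row_col mulmx1 mulmx0 addr0.
  by rewrite mulmxA.
have We j : j != i -> W j *m e j = W j.
  move=> ji; have /submxP[D ->] : (W j <= (Y j : 'M_(rsize X + rsize X)) *m
    L)%MS.
    by rewrite genmxE.
  by rewrite -!mulmxA (mulmxA (Y j)) YLe.
have rW j : j != i -> \rank (W j) = \rank (Y j).
  move=> ji; rewrite genmxE; apply/eqP; rewrite eqn_leq mxrankM_maxl /=.
  by rewrite [X in (\rank X <= _)%N](Yj j ji) mulmxA mxrankM_maxl.
have rT : \rank T = \rank (Y i).
  apply/eqP; rewrite eqn_leq mxrankM_maxl /=.
  by rewrite [X in (\rank X <= _)%N]Yi mxrankM_maxl.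
have WS j : adj i j -> (W j <= S)%MS.
  by move=> aij; rewrite /S (sumsmx_sup j).
have E1 j : j != i ->
    row_mx 0 p *m rarr refl_rep *m rvert refl_rep j *m L = p *m e j.
  move=> /negPf ji; rewrite /= ji !mul_row_block mul_row_col.
  by rewrite !(mul0mx, mulmx0, addr0, add0r) mulmx1 out_kerK.
have E2 j k : j != i -> k != i ->
    row_mx (e j) 0 *m rarr refl_rep *m rvert refl_rep k *m L = e j *m b *m e k.
  move=> /negPf ji /negPf ki; rewrite /= ki !mul_row_block mul_row_col.
  rewrite !(mul0mx, mulmx0, addr0, add0r) mulmx1 -!mulmxA unit_sub_vert ki
    !mulmxA.
  by rewrite vert_unit_sub ji.
have E3 j k : j != i -> k != i ->
    row_mx (e j) 0 *m rarr refl_rep *m rvert refl_rep i *m rarr refl_rep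
      *m rvert refl_rep k *m L = e j *m o *m b *m e k.
  move=> /negPf ji /negPf ki; rewrite /= ki eqxx !mul_row_block mul_row_col.
  rewrite !(mul0mx, mulmx0, addr0, add0r) mulmx1 (mulmxA o) out_vert.
  have obp : o *m b *m p = o *m b by rewrite -out_vert -!(mulmxA o)
    vert_arr_ker.
  by rewrite -(mulmxA _ p p) out_kerK -(mulmxA (e j)) obp mulmxA.
have Tp : T *m p = T.
  by rewrite {2}/T Yi -mulmxA mul_row_col mul0mx mulmx1 add0r.
have TS : (T <= S)%MS.
  rewrite -Tp -out_ker_nbr mulmxA Tp /q /nbr mulmx_sumr;
    apply: summx_sub => j aij.
  apply: submx_trans (WS j aij); rewrite genmxE.
  have := submxMr L (subrep_arr sY i j).
  by rewrite Yi -!(mulmxA T) E1 ?ij // mulmxA Tp.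
have Wsub j k (A : 'M[K]_(rsize X)) : ((Y j : 'M_(rsize X + rsize X)) *m L *m A
    <= (Y k : 'M_(rsize X + rsize X)) *m L)%MS -> (W j *m A <= W k)%MS.
  move=> YA; rewrite genmxE; apply: submx_trans YA; apply: submxMr.
  by rewrite genmxE.
exists Z; split.
  split=> [j|j k]; rewrite /Z.
    by case: eqP => [->|/eqP ji]; [rewrite -mulmxA out_vert|exact: We].
  have [ji|ji] := eqVneq j i; have [ki|ki] := eqVneq k i.
  - have obe : o *m b *m e i = 0 by rewrite -out_vert -!(mulmxA o)
    vert_arr_vert mulmx0.
    by rewrite ki -!(mulmxA S) obe mulmx0 sub0mx.
  - rewrite -!(mulmxA S) sumsmxMr; apply/sumsmx_subP => l /ij li.
    apply: Wsub.
    have <- : (Y l : 'M_(rsize X + rsize X)) *m rarr refl_rep *m rvert refl_rep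
      i
        *m rarr refl_rep *m rvert refl_rep k *m L =
        (Y l : 'M_(rsize X + rsize X)) *m L *m (o *m b *m e k).
      rewrite [in LHS](Yj l li) (mulmxA _ L) -!(mulmxA (_ *m L)) E3 //.
      by rewrite -!(mulmxA (e l)) mulmxA YLe.
    apply: submxMr; apply: submx_trans (subrep_arr sY i k).
    by apply: submxMr; apply: submxMr; exact: (subrep_arr sY l i).
  - rewrite -mulmxA; have [aij|aij] := boolP (adj i j).
      by rewrite ki; apply: submxMr; exact: WS.
    rewrite -(We j ji) -(mulmxA (W j)) mulmxA -(mulmxA (W j)) (mulmxA (e j)).
    by rewrite ki (rarr_adj rX) ?mulmx0 ?sub0mx // adj_sym.
  - rewrite -mulmxA; apply: Wsub.
    have <- : (Y j : 'M_(rsize X + rsize X)) *m rarr refl_rep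
         *m rvert refl_rep k *m L =
        (Y j : 'M_(rsize X + rsize X)) *m L *m (b *m e k).
      rewrite [in LHS](Yj j ji) (mulmxA _ L) -!(mulmxA (_ *m L)) E2 //.
      by rewrite -!(mulmxA (e j)) mulmxA YLe.
    by apply: submxMr; exact: (subrep_arr sY j k).
exists (\sum_(j | adj i j) \rank (Y j) - \rank (Y i) - \rank (S *m o))%N.
(* The space [Y i], seen as [T], lies in [S] and in the kernel of [o], so this is rank and nullity
   for [o] on [S]. It makes the truncated subtractions in the witness exact. *)
have le : (\rank (S *m o) + \rank (Y i) <= \sum_(j | adj i j) \rank (Y j))%N.
  rewrite (_ : \sum_(j | adj i j) _ = \sum_(j | adj i j) \rank (W j))%N;
    last first.
    by apply: eq_bigr => j /ij ji; rewrite rW.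
  apply: leq_trans (rank_sumsmx_le _ W); rewrite -/S.
  rewrite -(mxrank_mul_ker S o) leq_add2l -rT mxrankS // sub_capmx TS /=.
  by apply/sub_kermxP; rewrite -Tp -mulmxA out_ker_out mulmx0.
apply/ffunP => j; rewrite reflE [in RHS]ffunE [sdim X Z j]ffunE /Z ffunMnE
  !ffunE.
case: eqP => [->|/eqP ji]; last by rewrite mul0r mul0rn subr0 addr0 rW.
rewrite mul1r /cart ffunE.
rewrite (eq_bigr (fun j => (\rank (Y j))%:Z)) => [|k _]; last by rewrite ffunE.
rewrite -(big_morph Posz PoszD (erefl _)) natz -[Posz true]/(1 : int) natz.
move: le; set r := \rank (S *m o); set y := \rank (Y i).
set M := (\sum_(j | _) _)%N => le.
have E : M = (r + y + (M - y - r))%N by rewrite -subnDA (addnC r) subnKC //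
  addnC.
by rewrite {1}E !PoszD mulr2n; ring.
Qed.
End Reflection.

(** * Homomorphisms between reflected representations *)

Section ReflectionHom.
Variables (X Y : rep) (i : V).
Hypotheses (rX : is_rep X) (rY : is_rep Y).
Hypotheses (adj_sym : symmetric adj) (adj_irr : irreflexive adj).
Hypotheses (topX : no_top X i) (topY : no_top Y i).

Lemma rarr_split (Z : rep) : is_rep Z -> rarr Z =
  (runit Z - rvert Z i) *m rarr Z *m (runit Z - rvert Z i)
  + rarr Z *m rvert Z i + rvert Z i *m rarr Z.
Proof.
move=> rZ; rewrite mulmxBl mulmxBr mulmxBl mulmxBl.
rewrite rarrEl // rarrEr // (rarr_adj rZ) ?adj_irr // subr0 -(mulmxA _ _ (runit
  Z)).
by rewrite rarrEr // subrK subrK.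
Qed.

(** The reflection is full: as [o] is surjective, the space at [i] is the quotient of the
    neighbouring spaces by the kernel of [o], and the component [A] of [f'] descends to it because
    [D] is its restriction to the kernels. The formula for [f'] shows that it is determined by
    [f]. *)
Lemma refl_hom f' : rhom (refl_rep X i) (refl_rep Y i) f' ->
  exists f, rhom X Y f /\ f' =
    block_mx ((runit X - rvert X i) *m f) 0 0
      (out_ker X i *m (runit X - rvert X i) *m f).
Proof.
case=> comm_e comm_b unit_f.
pose A : 'M[K]_(rsize X, rsize Y) := ulsubmx f'.
pose B : 'M[K]_(rsize X, rsize Y) := ursubmx f'.
pose C : 'M[K]_(rsize X, rsize Y) := dlsubmx f'.
pose D : 'M[K]_(rsize X, rsize Y) := drsubmx f'.
have Ef : f' = block_mx A B C D by rewrite submxK.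
move: comm_e comm_b unit_f; rewrite runit_refl // Ef.
set U := runit X - _; set U1 := runit Y - rvert Y i.
set p := out_ker X i; set p1 := out_ker Y i.
set e := rvert X; set e1 := rvert Y; set o := rarr X *m e i.
set o1 := rarr Y *m e1 i.
move=> comm_e; rewrite /= !mulmx_block !(mul0mx, mulmx0, addr0, add0r).
move=> /eq_block_mx[bA oD pA _] /eq_block_mx[UA UB pC pD].
have /= := comm_e i; rewrite eqxx !mulmx_block !(mul0mx, mulmx0, addr0, add0r).
move=> /eq_block_mx[_ _ pC0 Dp].
have C0 : C = 0 by rewrite -pC.
have eA j : j != i -> e j *m A = A *m e1 j.
  move=> /negPf ji; have /= := comm_e j.
  by rewrite ji !mulmx_block !(mul0mx, mulmx0, addr0, add0r) => /eq_block_mx[].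
have eB j : j != i -> e j *m B = 0.
  move=> /negPf ji; have /= := comm_e j.
  by rewrite ji !mulmx_block !(mul0mx, mulmx0, addr0, add0r) => /eq_block_mx[].
have B0 : B = 0.
  by rewrite -UB /U runit_sub mulmx_suml big1 // => j /eB.
move: bA oD pA; rewrite C0 B0 !(mul0mx, mulmx0, addr0, add0r) => bA oD pA.
have eU0 : e i *m U = 0 by rewrite vert_unit_sub // eqxx.
have Ue0 : U *m e i = 0 by rewrite unit_sub_vert // eqxx.
have eU10 : e1 i *m U1 = 0 by rewrite vert_unit_sub // eqxx.
have Ue10 : U1 *m e1 i = 0 by rewrite unit_sub_vert // eqxx.
have AU : A *m U1 = A.
  rewrite -[RHS]UA /U1 /U !runit_sub.
  by rewrite mulmx_sumr mulmx_suml; apply: eq_bigr => j /eA.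
have qA : nbr X i *m A = A *m nbr Y i.
  rewrite mulmx_sumr mulmx_suml; apply: eq_bigr => j ij; rewrite eA //.
  by apply: contraTneq ij => ->; rewrite adj_irr.
set s := out_sec X i.
have oe' : o *m e i = o by exact: out_vert.
have oe1' : o1 *m e1 i = o1 by exact: out_vert.
have eA0 : e i *m A = 0 by rewrite -UA mulmxA eU0 mul0mx.
have Ae0 : A *m e1 i = 0 by rewrite -AU -mulmxA Ue10 mulmx0.
(* This says that [A *m o1] factors through [o]: the complement [p] of [o *m s] is sent by [A] into
   the kernel of [o1]. *)
have osA : o *m s *m A *m o1 = A *m o1.
  have -> : o *m s = nbr X i - p by rewrite /p /out_ker opprB addrC subrK.
  rewrite mulmxBl pA mulmxBl -(mulmxA D) out_ker_out // mulmx0 subr0 qA.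
  by rewrite -mulmxA nbr_out.
have es' : e i *m s = s by exact: vert_out_sec.
have so' : s *m o = e i by exact: out_secK.
have sU : s *m U = s by rewrite /s -out_sec_nbr // -mulmxA nbr_unit_sub.
have Us0 : U *m s = 0 by rewrite -es' mulmxA Ue0 mul0mx.
have UA' : U *m (A + s *m (A *m o1)) = A.
  by rewrite mulmxDr UA (mulmxA U) Us0 mul0mx addr0.
exists (A + s *m (A *m o1)); split; last first.
  by rewrite -(mulmxA p) UA' pA -Dp pD.
have osA' : o *m (s *m (A *m o1)) = A *m o1 by rewrite -[RHS]osA -!(mulmxA o)
  -(mulmxA s).
split.
- move=> j; rewrite mulmxDr mulmxDl -/(e j) -/(e1 j) -(mulmxA s) -(mulmxA A).
  have [->|ji] := eqVneq j i.
    by rewrite eA0 Ae0 !add0r (mulmxA (e i)) es' oe1'.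
  rewrite eA // -es' -(mulmxA (e i)) (mulmxA (e j)) (rvertM rX) (negPf ji)
    mul0mx.
  by rewrite -oe1' -(mulmxA o1) (rvertM rY) eq_sym (negPf ji) !mulmx0.
- rewrite (rarr_split rX) (rarr_split rY) -/U -/U1 -/o -/o1 -/e -/e1.
  set t := e i *m rarr X; set t1 := e1 i *m rarr Y.
  set c := U *m rarr X *m U; set c1 := U1 *m rarr Y *m U1.
  have oA0 : o *m A = 0 by rewrite -oe' -mulmxA eA0 mulmx0.
  have oU0 : o1 *m c1 = 0 by rewrite -oe1' /c1 -!(mulmxA o1) 2!(mulmxA (e1 i))
    eU10 !mul0mx mulmx0.
  have At0 : A *m t1 = 0 by rewrite (mulmxA A) Ae0 mul0mx.
  have oo0 : o1 *m o1 = 0.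
    by rewrite -[X in X *m _]oe1' -(mulmxA o1) (mulmxA (e1 i)) vert_arr_vert //
      mulmx0.
  have ts0 : t *m s = 0 by rewrite -es' (mulmxA t) vert_arr_vert // mul0mx.
  have tA : t *m A = s *m (A *m (o1 *m t1)).
    have tp : t *m p = t by exact: vert_arr_ker.
    rewrite -oD -(mulmxA o) (mulmxA s) so' (mulmxA (e i)) (mulmxA (e i)).
    by rewrite (rvertM rX) eqxx -/t -tp -(mulmxA t) pA -Dp (mulmxA t).
  have cs0 : c *m s = 0 by rewrite /c -(mulmxA _ U) Us0 mulmx0.
  rewrite !mulmxDl !mulmxDr bA oA0 osA' (mulmxA c) cs0 (mulmxA t) ts0 !mul0mx.
  rewrite -!(mulmxA s) -!(mulmxA A) oU0 oo0 -tA At0 !mulmx0.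
  by rewrite !(addr0, add0r).
- have -> : runit X = U + e i by rewrite subrK.
  by rewrite mulmxDl UA' mulmxDr eA0 add0r (mulmxA (e i)) es'.
Qed.
End ReflectionHom.

(** * Reduction of a semibrick to simple representations *)

Section Process.
Hypotheses (adj_sym : symmetric adj) (adj_irr : irreflexive adj).

Lemma rorth_refl X Y i : is_rep X -> is_rep Y -> no_top X i -> no_top Y i ->
  rorth X Y -> rorth (refl_rep X i) (refl_rep Y i).
Proof.
move=> rX rY tX tY oXY f' /(refl_hom rX rY adj_sym adj_irr tX tY)[f [/oXY->
  ->]].
by rewrite !mulmx0 block_mx0.
Qed.

Lemma rbrick_refl X i : is_rep X -> no_top X i ->
  rbrick X -> rbrick (refl_rep X i).
Proof.
move=> rX tX [U0 bX]; split.
  rewrite runit_refl // block_mx_eq0 negb_and; apply/orP; left.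
  apply: contra U0 => /eqP U0.
  (* If the reflection vanished, X would be concentrated at [i]; but the section [s] identifies the
     space at [i] with a part of the neighbouring ones. *)
  have e0 : rvert X i = 0.
    rewrite -(out_secK rX adj_sym tX) -(out_sec_nbr i rX) -(nbr_unit_sub i rX
      adj_irr) U0.
    by rewrite !mulmx0 mul0mx.
  by rewrite -[runit X](subrK (rvert X i)) U0 e0 addr0.
move=> f' /(refl_hom rX rX adj_sym adj_irr tX tX)[f [/bX[c ->] ->]].
exists c; rewrite runit_refl // scale_block_mx !scaler0 -!scalemxAr.
have WU : (runit X - rvert X i) *m runit X = runit X - rvert X i.
  by rewrite mulmxBl runitK // runitr.
by rewrite -mulmxA WU out_ker_unit_sub.
Qed.

Variable x : {ffun V -> int}.
Hypotheses (x_gt0 : forall i, 0 < x i) (x_dom : forall i, 0 < cart adj x i).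

(* Reflecting a semibrick at a vertex of its socle strictly lowers the height
   of the image of the dominant vector [x], which is bounded below. *)
Theorem semibrick_roots (L : finType) (X : L -> rep) :
  (forall l, is_rep (X l)) -> (forall l, rbrick (X l)) ->
  (forall l m, l != m -> rorth (X l) (X m)) ->
  exists ws (k : L -> V), forall l, rdim (X l) = wact adj ws (alpha (k l)).
Proof.
(* The induction is on a bound for the height, shifted by [form x x] to be nonnegative. The
   condition on subrepresentations provides the positivity of [wact ws (alpha i)] that makes the
   height drop. *)
suff H n : forall ws (X : L -> rep),
    form adj (wact adj ws x) x + form adj x x < n%:Z ->
    (forall l, is_rep (X l)) -> (forall l, rbrick (X l)) ->
    (forall l m, l != m -> rorth (X l) (X m)) ->
    (forall l (Y : V -> 'M[K]_(rsize (X l))), is_subrep (X l) Y -> forall i, 0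
      <= wact adj ws (sdim (X l) Y) i) ->
    exists ws' (k : L -> V), forall l,
      wact adj ws (rdim (X l)) = wact adj ws' (alpha (k l)).
  move=> rX bX oX.
  have f0 := form_ge0 adj_sym x_gt0 x_dom x.
  have [||||l Y _ i|ws [k kP]] :=
      H (absz (form adj x x + form adj x x + 1)) [::] X => //.
  - by rewrite gez0_abs ?addr_ge0 // ltrDl.
  - by rewrite ffunE.
  by exists ws, k.
elim: n => [|n IH] ws {}X lt_n rX bX oX sX.
  have := height_ge adj_sym adj_irr x_gt0 x_dom ws.
  by rewrite -subr_ge0 opprK leNgt lt_n.
have [smp|nsmp] := pselect (forall l, exists i, rdim (X l) = alpha i).
  have [k kP] := choice smp.
  by exists ws, k => l; rewrite kP.
have [l0 nl0] : exists l, forall i, rdim (X l) <> alpha i.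
  apply: contrapT => h; apply: nsmp => l; apply: contrapT => h'; apply: h.
  by exists l => i ri; apply: h'; exists i.
have [i [v sv]] := exists_socle (rX l0) adj_sym x_gt0 x_dom (bX l0).1.
case: (sv) => v0 vi vb.
(* Otherwise a quotient map from [X l] to S_i followed by its embedding in [X l0] is a nonzero
   homomorphism [u *m v] of rank one. Orthogonality forces [l = l0]; then it is a nonzero multiple
   of the identity, and [X l0] has dimension vector [alpha i], contrary to its choice. *)
have top l : no_top (X l) i.
  apply: contrapT => /negP ntop.
  have [u [u0 ui ub]] : exists u : 'cV[K]_(rsize (X l)),
      [/\ u != 0, rvert (X l) i *m u = u & rarr (X l) *m u = 0].
    move: ntop; rewrite /no_top submxE => /matrix0Pn[r [k rk]].
    move: rk; have := mulmx_coker (rarr (X l) *m rvert (X l) i).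
    move: (cokermx _) => c bc rk.
    exists (col k (rvert (X l) i *m c)); split.
    - by apply/matrix0Pn; exists r, ord0; rewrite mxE.
    - by rewrite colE !mulmxA (rvertM (rX l)) eqxx.
    - by rewrite colE !mulmxA bc mul0mx.
  have hf : rhom (X l) (X l0) (u *m v).
    split.
    - move=> j; rewrite -ui -[v in LHS]vi -[v in RHS]vi.
      rewrite !mulmxA (rvertM (rX l)) -!mulmxA (rvertM (rX l0)) eq_sym.
      by case: eqP => [->|_]; rewrite ?mul0mx ?mulmx0.
    - by rewrite mulmxA ub mul0mx -mulmxA vb mulmx0.
    - by rewrite -ui !mulmxA runitl.
  have uv0 : u *m v != 0.
    have /matrix0Pn[r [z]] := u0; have /matrix0Pn[z' [k]] := v0.
    rewrite !ord1 => vk ur; apply/matrix0Pn; exists r, k.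
    by rewrite mxE big_ord1 mulf_neq0.
  have [e|ne] := eqVneq l l0; last by case/eqP: uv0; exact: (oX _ _ ne).
  subst l; have [c uvc] := (bX l0).2 _ hf.
  have c0 : c != 0 by apply: contraNneq uv0 => c0; rewrite uvc c0 scale0r.
  have Uuv : runit (X l0) = c^-1 *: (u *m v) by rewrite uvc scalerA mulVf
    ?scale1r.
  case: (nl0 i); apply/ffunP => j; rewrite !ffunE.
  rewrite -(runitr (rX l0)) Uuv -scalemxAr -ui !mulmxA (rvertM (rX l0)).
  case: eqP => [->|_]; last by rewrite !mul0mx scaler0 mxrank0.
  rewrite ui; apply/eqP; rewrite eqz_nat eqn_leq; apply/andP; split.
    rewrite scalemxAl; apply: leq_trans (mxrankM_maxl _ _) _.
    exact: rank_leq_col.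
  by rewrite lt0n mxrank_eq0 scaler_eq0 negb_or invr_eq0 c0.
have nX l : is_rep (refl_rep (X l) i) by exact: is_rep_refl.
have wi : forall j, 0 <= wact adj ws (alpha i) j.
  have sY : is_subrep (X l0) (fun j => if j == i then <<v>>%MS else 0).
    have /submxP[D DE] : (<<v>> <= v)%MS by rewrite genmxE.
    split=> [j|j k]; case: eqP => [ji|_]; rewrite ?mul0mx ?sub0mx //.
      by rewrite ji DE -mulmxA vi.
    by rewrite DE -(mulmxA D) vb mulmx0 mul0mx sub0mx.
  move=> j; have := sX l0 _ sY j; rewrite (_ : sdim _ _ = alpha i) //.
  apply/ffunP => k; rewrite !ffunE; case: eqP => _; last by rewrite mxrank0.
  by rewrite genmxE rank_rV v0.
have [||l|l m lm|l Y|ws' [k kP]] := IH (rcons ws i) (fun l => refl_rep (X l) i).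
- have := form_dom_refl adj_irr x_dom wi.
  by move=> h; move: lt_n h; lia.
- exact: nX.
- exact: rbrick_refl.
- by apply: rorth_refl => //; exact: oX.
(* The vector to test is the image under [wact ws] of [sdim Z + alpha i *+ m], and both summands
   have nonnegative images. *)
- move=> sY j; have [Z [sZ [m rZ]]] := refl_subrep (rX l) adj_sym adj_irr (top
  l) sY.
  rewrite /wact foldr_rcons -/(wact _ _ _) rZ raddfD /= raddfMn /= ffunE
    ffunMnE.
  by rewrite addr_ge0 ?mulrn_wge0 ?(sX l).
exists ws', k => l; rewrite -kP rdim_refl //.
by rewrite /wact foldr_rcons reflK.
Qed.

End Process.
End Representations.

Arguments rhom {K V} X Y f.
Arguments rorth {K V} X Y.
Arguments is_subrep {K V} X Y.
Arguments sdim {K V} X Y.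
Arguments in_socle {K V} X i v.

(** * Hankel matrices and their realisation *)

Section FiniteRank.
Variable K : fieldType.

Definition mxf (A B : finType) (f : A -> B -> K) : 'M[K]_(#|A|, #|B|) :=
  \matrix_(i, j) f (enum_val i) (enum_val j).

Lemma mxfM (A B C : finType) (f : A -> B -> K) (g : B -> C -> K) :
  mxf f *m mxf g = mxf (fun a c => \sum_b f a b * g b c).
Proof.
apply/matrixP => i j; rewrite !mxE [RHS](reindex (fun k : 'I_#|B| => enum_val
  k)) /=; last first.
  exact/onW_bij/enum_val_bij.
by apply: eq_bigr => k _; rewrite !mxE.
Qed.

Definition rowf (B : finType) (f : B -> K) : 'rV[K]_#|B| :=
  \row_(j < #|B|) f (enum_val j).

Lemma submx_mxf (A B : finType) m (f : A -> B -> K) (N : 'M_(m, #|B|)) :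
  (forall a, (rowf (f a) <= N)%MS) -> (mxf f <= N)%MS.
Proof.
move=> fN; apply/row_subP => i; apply: submx_trans (fN (enum_val i)).
by rewrite (_ : row i _ = rowf (f (enum_val i))) //;
  apply/rowP => j; rewrite !mxE.
Qed.

Lemma row_mxf (A B : finType) (f : A -> B -> K) a :
  (rowf (f a) <= mxf f)%MS.
Proof.
apply: submx_trans (row_sub (enum_rank a) _).
by rewrite (_ : row _ _ = rowf (f a)) //;
  apply/rowP => j; rewrite !mxE enum_rankK.
Qed.

Lemma rank_mxf_rows (A A' B : finType) (f : A -> B -> K) (f' : A' -> B -> K) :
  (forall a, (exists a', forall b, f a b = f' a' b) \/ forall b, f a b = 0) ->
  (\rank (mxf f) <= \rank (mxf f'))%N.
Proof.
move=> ff'; apply/mxrankS/submx_mxf => // a; case: (ff' a) => [[a' E]|E].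
  rewrite (_ : rowf _ = rowf (f' a')); first exact: row_mxf.
  by apply/rowP => j; rewrite !mxE.
rewrite (_ : rowf _ = 0) ?sub0mx //.
by apply/rowP => j; rewrite !mxE.
Qed.

Lemma rank_mxf_cols (A B B' : finType) (f : A -> B -> K) (f' : A -> B' -> K) :
  (forall b, (exists b', forall a, f a b = f' a b') \/ forall a, f a b = 0) ->
  (\rank (mxf f) <= \rank (mxf f'))%N.
Proof.
have trE (D : finType) (g : A -> D -> K) : \rank (mxf g) = \rank (mxf (fun d a
  => g a d)).
  rewrite -mxrank_tr; congr (\rank _); apply/matrixP => i j; rewrite !mxE //.
by move=> ff'; rewrite !trE; exact: rank_mxf_rows.
Qed.

Section Factorisation.
Variables (A B : Type) (H : A -> B -> K) (D : nat).
Hypothesis H_rank : forall p q (a : 'I_p -> A) (b : 'I_q -> B),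
  (\rank (\matrix_(s, t) H (a s) (b t)) <= D)%N.

(* A maximal invertible minor [M] of [H] gives [H x y = (H x b) M^-1 (H a y)],
   since every minor bordering [M] vanishes. *)
Lemma finite_rank_factor :
  exists d (l : A -> 'rV[K]_d) (r : B -> 'cV[K]_d),
  [/\ forall x y, l x *m r y = (H x y)%:M,
      exists a : 'I_d -> A, forall s, l (a s) = delta_mx 0 s &
      forall m (u : 'M_(m, d)), (forall y, u *m r y = 0) -> u = 0].
Proof.
pose P d := `[< exists (a : 'I_d -> A) (b : 'I_d -> B),
  \matrix_(s, t) H (a s) (b t) \in unitmx >].
have P0 : exists d, P d.
  exists 0%N; apply/asboolP.
  have f T : 'I_0 -> T by case.
  by exists (f A), (f B); rewrite unitmxE det_mx00 unitr1.
have PD d : P d -> (d <= D)%N.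
  case/asboolP => a [b u]; rewrite -(mxrank_unit u); exact: H_rank.
case: (ex_maxnP P0 PD) => d /asboolP[a [b]].
set M := \matrix_(s, t) _ => uM maxd.
pose w x : 'rV[K]_d := \row_t H x (b t).
pose r y : 'cV[K]_d := \col_s H (a s) y.
exists d, (fun x => w x *m invmx M), r; split.
- move=> x y; apply/eqP; rewrite -subr_eq0; apply: contraT => nz.
  (* Border [M] by the row of [x] and the column of [y]. The block factorisation gives determinant
     [\det M] times the defect [H x y - w x *m invmx M *m r y], so a nonzero defect would give a
     larger invertible minor. *)
  pose a' (s : 'I_(d + 1)) := if split s is inl s' then a s' else x.
  pose b' (s : 'I_(d + 1)) := if split s is inl s' then b s' else y.
  have : P (d + 1)%N.
    apply/asboolP; exists a', b'.
    have -> : \matrix_(s, t) H (a' s) (b' t) =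
        block_mx 1%:M 0 (w x *m invmx M) (1%:M : 'M_1) *m
        block_mx M (r y) 0 ((H x y)%:M - w x *m invmx M *m r y).
      rewrite mulmx_block !(mul0mx, mulmx0, addr0, add0r) !mul1mx mulmxKV //.
      rewrite addrC subrK; apply/matrixP => s t; rewrite !mxE /a' /b'.
      case: (split s) => s'; rewrite !mxE; case: (split t) => t';
        rewrite !mxE //.
      by rewrite !ord1 eqxx.
    rewrite unitmxE det_mulmx det_lblock det_ublock !det1 !mul1r unitrM.
    rewrite -!unitmxE uM /=.
    move: nz; rewrite -oppr_eq0 opprB; move: (_ - _) => N nz.
    rewrite unitmxE unitfE det_mx11; apply: contra nz => /eqP N0.
    by apply/eqP/matrixP => i j; rewrite !ord1 N0 mxE.
  by move/maxd; rewrite addn1 ltnn.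
- exists a => s; rewrite (_ : w (a s) = row s M).
    by rewrite -row_mul mulmxV // row1.
  by apply/rowP => t; rewrite !mxE.
- move=> m u u0; rewrite -[u](mulmxK uM) (_ : u *m M = 0) ?mul0mx //.
  apply/matrixP => i t; have := congr1 (fun N : 'M_(m, 1) => N i 0) (u0 (b t)).
  by rewrite !mxE => E; rewrite -[RHS]E; apply: eq_bigr => s _; rewrite !mxE.
Qed.

End Factorisation.
End FiniteRank.

Lemma sum_eqr (K : fieldType) (B : finType) (F : B -> K) b0 :
  \sum_b F b * (b == b0)%:R = F b0.
Proof.
rewrite (bigD1 b0) //= eqxx mulr1 big1 ?addr0 // => b /negPf->.
by rewrite mulr0.
Qed.

(* In the application [G u] is the action of the sum of all paths that start outside [I],
   run through the word [u] of vertices of [I], and end outside [I].  The Hankel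
   matrix at [i] has the entries [G (u ++ i :: v)]. *)
Section Hankel.
Variables (K : fieldType) (V : finType) (adj : rel V) (n : nat).
Hypothesis adj_sym : symmetric adj.
Variable G : seq V -> 'M[K]_n.
Hypothesis G_adj : forall u i j v, ~~ adj i j -> G (u ++ [:: i, j & v]) = 0.
Hypothesis G_rel : forall u i v,
  \sum_k G (u ++ [:: i, k, i & v]) + G (rcons u i) *m G (i :: v) = 0.

Definition hankel i k m : 'M[K]_(#|{: k.-bseq V * 'I_n}|, #|{: m.-bseq V *
  'I_n}|) :=
  mxf (fun (a : k.-bseq V * 'I_n) (b : m.-bseq V * 'I_n) =>
    G (a.1 ++ i :: b.1) a.2 b.2).

Lemma hankel_mono i k k' m m' : (k <= k')%N -> (m <= m')%N ->
  (\rank (hankel i k m) <= \rank (hankel i k' m'))%N.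
Proof.
move=> kk mm; apply: (@leq_trans (\rank (hankel i k' m))).
  apply: rank_mxf_rows => a; left.
  by exists (widen_bseq kk a.1, a.2) => b.
apply: rank_mxf_cols => b; left.
by exists (widen_bseq mm b.1, b.2) => a.
Qed.

(** The rank of [hankel i k m] counts the states at [i] reached by words of length at most [k] and
    told apart by words of length at most [m]. One step out of [i] ([fA]) followed by one step into
    [i] ([fO]) is zero by [G_rel]. Both pass through the space [W] of states at the neighbours,
    enlarged by [n] dimensions for paths that leave the removed vertices. So the rank of [fA] is at
    most the nullity of [fO] on [W], and the image of [W] under [fO] contains the rows of
    [hankel i k.+2 m]. *)
Lemma hankel_step i k m :
  (\rank (hankel i k m.+2) + \rank (hankel i k.+2 m) <=
   \sum_(j | adj i j) \rank (hankel j k.+1 m.+1) + n)%N.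
Proof.
pose C : finType := (V * (m.+1.-bseq V * 'I_n) + 'I_n)%type.
pose fP j (a : k.+1.-bseq V * 'I_n) (c : C) := if c is inl (j', b) then
  if j == j' then G (a.1 ++ j :: b.1) a.2 b.2 else 0 else 0.
pose fN (x : 'I_n) (c : C) : K := if c is inr y then (x == y)%:R else 0.
pose fA (a : k.-bseq V * 'I_n) (c : C) := match c with
  | inl (j, b) => if adj i j then G (a.1 ++ [:: i, j & b.1]) a.2 b.2 else 0
  | inr y => G (rcons a.1 i) a.2 y end.
pose fO (c : C) (d : m.-bseq V * 'I_n) := match c with
  | inl (_, b) => (b == (cons_bseq i d.1, d.2))%:R
  | inr y => G (i :: d.1) y d.2 end.
pose W := ((\sum_(j | adj i j) <<mxf (fP j)>>) + <<mxf fN>>)%MS.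
have AE : (\rank (hankel i k m.+2) <= \rank (mxf fA))%N.
  apply: rank_mxf_cols => -[[[|j v] sv] y] /=.
    by left; exists (inr y) => a; rewrite cats1.
  have [ij|ij] := boolP (adj i j); last first.
    by right=> a; rewrite G_adj // mxE.
  left; exists (inl (j, (@Bseq m.+1 V v sv, y))) => a.
  by rewrite /fA ij.
have PW j a : adj i j -> (rowf (fP j a) <= W)%MS.
  move=> ij; apply: submx_trans (addsmxSl _ _).
  by rewrite (sumsmx_sup j) // genmxE row_mxf.
have NW x : (rowf (fN x) <= W)%MS.
  by apply: submx_trans (addsmxSr _ _); rewrite genmxE row_mxf.
have AW : (mxf fA <= W)%MS.
  apply: submx_mxf => -[u x].
  have -> : rowf (fA (u, x)) =
    \sum_(j | adj i j) rowf (fP j (rcons_bseq u i, x)) +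
    \sum_y G (rcons u i) x y *: rowf (fN y).
    apply/rowP => c; rewrite !mxE !summxE.
    case Ec: (enum_val c) => [[j b]|y]; last first.
      rewrite big1 ?add0r => [|j _]; last by rewrite mxE Ec.
      rewrite (eq_bigr (fun y' => G (rcons u i) x y' * (y' == y)%:R)) ?sum_eqr
        //.
      by move=> y' _; rewrite !mxE Ec.
    rewrite [X in _ + X]big1 ?addr0 => [|y _]; last by rewrite !mxE Ec mulr0.
    rewrite (eq_bigr (fun j' => if j' == j then G (u ++ [:: i, j & b.1]) x b.2
      else 0)).
      rewrite -big_mkcondr /=; case: ifP => ij.
        rewrite (big_pred1 j) // => j'; rewrite andbC /=.
        by case: eqP => // ->.
      by rewrite big_pred0 // => j'; apply/andP => -[ij' /eqP j'j];
        rewrite -j'j ij' in ij.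
    by move=> j' _; rewrite mxE Ec /=; case: eqP => // ->; rewrite cat_rcons.
  by rewrite addmx_sub ?summx_sub // => j ij; rewrite ?scalemx_sub ?PW.
have MO (f : C -> K) d : \sum_c f c * fO c d =
    \sum_j f (inl (j, (cons_bseq i d.1, d.2))) + \sum_y f (inr y) * G (i ::
      d.1) y d.2.
  rewrite big_sumType /=; congr (_ + _).
  rewrite [LHS](eq_bigr (fun p => f (inl (p.1, p.2)) * fO (inl (p.1, p.2)) d));
    last by case.
  rewrite -(pair_bigA _ (fun j b => f (inl (j, b)) * fO (inl (j, b)) d)) /=.
  by apply: eq_bigr => j _; rewrite sum_eqr.
have AO : mxf fA *m mxf fO = 0.
  rewrite mxfM; apply/matrixP => s t; rewrite !mxE MO.
  case: (enum_val s) (enum_val t) => [u x] [v y] /=.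
  have := congr1 (fun M : 'M_n => M x y) (G_rel u i v).
  rewrite !mxE summxE => E; rewrite -[RHS]E; congr (_ + _).
  apply: eq_bigr => j _.
  by case: ifPn => // ij; rewrite G_adj // mxE.
have HWO : (hankel i k.+2 m <= W *m mxf fO)%MS.
  apply: submx_mxf => -[[u su] x] /=.
  have rowO (f : C -> K) (g : m.-bseq V * 'I_n -> K) : (rowf f <= W)%MS ->
      (forall d, g d = \sum_j f (inl (j, (cons_bseq i d.1, d.2))) +
        \sum_y f (inr y) * G (i :: d.1) y d.2) -> (rowf g <= W *m mxf fO)%MS.
    move=> fW gE; apply: submx_trans (submxMr (mxf fO) fW).
    rewrite (_ : rowf g = rowf f *m mxf fO) //.
    apply/rowP => d; rewrite mxE gE -MO mxE.
    rewrite (reindex (fun c : 'I_#|C| => enum_val c)) /=; last first.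
      exact/onW_bij/enum_val_bij.
    by apply: eq_bigr => c _; rewrite !mxE.
  case: (lastP u) su => [|{}u j] su.
    apply: rowO (NW x) _ => d.
    rewrite big1 // add0r (bigD1 x) //= eqxx mul1r big1 ?addr0 // => y /negPf
      yx.
    by rewrite eq_sym yx mul0r.
  have [ij|ij] := boolP (adj i j); last first.
    rewrite (_ : rowf _ = 0) ?sub0mx //; apply/rowP => d; rewrite !mxE /=.
    by rewrite cat_rcons G_adj ?mxE // adj_sym.
  have su' : (size u <= k.+1)%N by rewrite size_rcons in su.
  apply: rowO (PW j (Bseq su', x) ij) _ => d.
  rewrite [X in _ = _ + X]big1 ?addr0 => [|y _]; last by rewrite mul0r.
  rewrite (bigD1 j) //= eqxx big1 ?addr0 ?cat_rcons // => j' /negPf j'j.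
  by rewrite eq_sym j'j.
apply: (@leq_trans (\rank (mxf fA) + \rank (W *m mxf fO))).
  by apply: leq_add AE _; exact: mxrankS.
apply: (@leq_trans (\rank W)).
  rewrite addnC -(mxrank_mul_ker W (mxf fO)) leq_add2l mxrankS // sub_capmx AW.
  exact/sub_kermxP.
apply: leq_trans (mxrank_adds_leqif _ _) _; apply: leq_add; last first.
  by rewrite genmxE -[X in (_ <= X)%N]card_ord rank_leq_row.
apply: leq_trans (rank_sumsmx_le _ _) _; apply: leq_sum => j _.
rewrite genmxE; apply: rank_mxf_cols => -[[j' b]|y]; last by right.
by rewrite /fP; case: eqP => [_|_]; [left; exists b|right].
Qed.
End Hankel.

(** * Bounded growth from a strictly dominant vector *)

Section Growth.
Variables (V : finType) (adj : rel V) (n : nat).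
Hypothesis adj_sym : symmetric adj.
Variable x : {ffun V -> int}.
Hypotheses (x_gt0 : forall i, 0 < x i) (x_dom : forall i, 0 < cart adj x i).

(* The increments of [k |-> sum_i x_i d_i(k)] drop by at least one as long as
   [sum_i d_i] exceeds [n * sum_i x_i], but they are nonnegative. *)
Lemma growth_bound (d : V -> nat -> nat) :
  (forall i k, d i k <= d i k.+1)%N ->
  (forall i k, d i k + d i k.+2 <= \sum_(j | adj i j) d j k.+1 + n)%N ->
  forall k, \sum_i (d i k)%:Z <= n%:Z * \sum_i x i.
Proof.
move=> dm dstep.
pose g k : int := \sum_i x i * (d i k)%:Z.
pose S k : int := \sum_i (d i k)%:Z.
pose c : int := n%:Z * \sum_i x i.
have Sm k k' : (k <= k')%N -> S k <= S k'.
  move=> /subnK <-; elim: (k' - k)%N => //= t IH; apply: le_trans IH _.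
  by apply: ler_sum => i _; rewrite lez_nat addSn.
have gm k : 0 <= g k.+1 - g k.
  rewrite subr_ge0; apply: ler_sum => i _.
  by rewrite ler_wpM2l ?lez_nat // ltW.
have gstep k : g k.+2 - g k.+1 <= g k.+1 - g k + (c - S k.+1).
  suff: g k + g k.+2 <= g k.+1 *+ 2 - S k.+1 + c by rewrite mulr2n; lra.
  apply: (@le_trans _ _ (\sum_i x i * (\sum_(j | adj i j) (d j k.+1)%:Z +
    n%:Z))).
    rewrite -big_split; apply: ler_sum => i _ /=.
    rewrite -mulrDr ler_wpM2l ?(ltW (x_gt0 i)) //.
    by rewrite -(big_morph Posz PoszD (erefl _)) -!PoszD lez_nat.
  under eq_bigr do rewrite mulrDr mulr_sumr.
  rewrite big_split /= /c -mulr_suml mulrC lerD2r.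
  rewrite (exchange_big_dep predT) //= -sumrMnl -sumrB; apply: ler_sum => j _.
  rewrite -mulr_suml (eq_bigl (adj j)) => [|i]; last by rewrite adj_sym.
  (* By integrality the sum of [x] over the neighbours of [j] is at most [x j *+ 2 - 1]; the spare 1
     yields the term [S k.+1]. *)
  have := x_dom j; rewrite /cart => h.
  rewrite -[X in _ - X]mul1r -mulrnAl -mulrBl ler_wpM2r //.
  move: h; set s := \sum_(i | _) _; lia.
move=> k0; rewrite -/(S k0) -/c leNgt -lezD1; apply/negP => lt.
have inc t : g (k0 + t).+1 - g (k0 + t)%N <= g k0.+1 - g k0 - t%:Z.
  elim: t => [|t IH]; first by rewrite addn0 subr0.
  rewrite addnS; have := gstep (k0 + t)%N; have := Sm k0 (k0 + t).+1.
  rewrite -addnS leq_addr => /(_ isT) h1 h2; rewrite intS.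
  move: lt h1 h2 IH; rewrite addnS; lra.
have := inc (absz (g k0.+1 - g k0)).+1;
  have := gm (k0 + (absz (g k0.+1 - g k0)).+1)%N.
rewrite intS gez0_abs // => h1 h2.
lra.
Qed.
End Growth.

Lemma stable_nat (f : nat -> nat) C : (forall m m', m <= m' -> f m <= f m')%N ->
  (forall m, f m <= C)%N -> exists m0, forall m, (m0 <= m)%N -> f m = f m0.
Proof.
move=> fm fC.
have ex : exists r, `[< exists m, f m = r >] by exists (f 0%N); apply/asboolP;
  exists 0%N.
have le r : `[< exists m, f m = r >] -> (r <= C)%N by move/asboolP => [m <-].
case: (ex_maxnP ex le) => r /asboolP[m0 <-] maxr; exists m0 => m mm.
apply/eqP; rewrite eqn_leq (fm _ _ mm) andbT; apply: maxr; apply/asboolP.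
by exists m.
Qed.

Section HankelRank.
Variables (K : fieldType) (V : finType) (adj : rel V) (n : nat).
Hypothesis adj_sym : symmetric adj.
Variable G : seq V -> 'M[K]_n.
Hypothesis G_adj : forall u i j v, ~~ adj i j -> G (u ++ [:: i, j & v]) = 0.
Hypothesis G_rel : forall u i v,
  \sum_k G (u ++ [:: i, k, i & v]) + G (rcons u i) *m G (i :: v) = 0.
Variable x : {ffun V -> int}.
Hypotheses (x_gt0 : forall i, 0 < x i) (x_dom : forall i, 0 < cart adj x i).

(** [hankel_step] mixes three column lengths, whereas [growth_bound] has a single parameter. The
    rank is monotone in the column length and bounded by the number of rows, so it stabilises, and
    the stable ranks satisfy the growth inequality. *)
Lemma hankel_bound k m :
  \sum_i (\rank (hankel G i k m))%:Z <= n%:Z * \sum_i x i.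
Proof.
have st k' i : exists m0, forall m, (m0 <= m)%N ->
    \rank (hankel G i k' m) = \rank (hankel G i k' m0).
  apply: (stable_nat (C := #|{: k'.-bseq V * 'I_n}|)) => [m1 m2 le|m1].
    exact: hankel_mono.
  exact: rank_leq_row.
have [m0 m0P] := choice (fun p : V * nat => st p.2 p.1).
pose M k' := (\max_i m0 (i, k'))%N.
have MP i k' m1 : (M k' <= m1)%N ->
    \rank (hankel G i k' m1) = \rank (hankel G i k' (m0 (i, k'))).
  move=> le; apply: (m0P (i, k')); apply: leq_trans le.
  exact: (leq_bigmax i).
pose d i k' := \rank (hankel G i k' (m0 (i, k'))).
apply: (@le_trans _ _ (\sum_i (d i k)%:Z)).
  apply: ler_sum => i _; rewrite lez_nat /d.
  rewrite -(MP i k (maxn m (M k))) ?leq_maxr //.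
  by apply: hankel_mono; rewrite ?leq_maxl.
apply: (growth_bound adj_sym x_gt0 x_dom) => [i k'|i k'].
  rewrite /d -(MP i k' (maxn (M k') (M k'.+1))) ?leq_maxl //.
  by rewrite -(MP i k'.+1 (maxn (M k') (M k'.+1))) ?leq_maxr // hankel_mono.
pose m1 := maxn (M k') (maxn (M k'.+1) (M k'.+2)).
have := hankel_step adj_sym G_adj G_rel i k' m1.
rewrite (MP i k' m1.+2) ?(MP i k'.+2 m1) -/(d _ _).
- by rewrite (eq_bigr (fun j => d j k'.+1)) => // j _; rewrite MP // /m1; lia.
- by rewrite /m1; lia.
- by rewrite /m1; lia.
Qed.

(** The Hankel matrices of all vertices and all lengths as one infinite matrix, block diagonal in
    the marked vertex. *)
Definition hankel_fun (a : seq V * V * 'I_n) (b : V * seq V * 'I_n) : K :=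
  if a.1.2 == b.1.1 then G (a.1.1 ++ a.1.2 :: b.1.2) a.2 b.2 else 0.

Lemma rank_ord_mxf p q (f : 'I_p -> 'I_q -> K) :
  (\rank (\matrix_(s, t) f s t) <= \rank (mxf f))%N.
Proof.
have -> : \matrix_(s, t) f s t = rowsub enum_rank 1%:M *m mxf f *m colsub
  enum_rank 1%:M.
  rewrite -rowsubE mulmx_colsub mulmx1.
  by apply/matrixP => s t; rewrite !mxE !enum_rankK.
by apply: leq_trans (mxrankM_maxl _ _) (mxrankM_maxr _ _).
Qed.

Lemma hankel_fun_rank p q (a : 'I_p -> seq V * V * 'I_n)
    (b : 'I_q -> V * seq V * 'I_n) :
  (\rank (\matrix_(s, t) hankel_fun (a s) (b t)) <= absz (n%:Z * \sum_i x
    i)%R)%N.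
Proof.
pose k := (\max_s size (a s).1.1)%N; pose m := (\max_t size (b t).1.2)%N.
pose f i s t := if ((a s).1.2 == i) && ((b t).1.1 == i)
  then G ((a s).1.1 ++ i :: (b t).1.2) (a s).2 (b t).2 else 0.
have -> : \matrix_(s, t) hankel_fun (a s) (b t) = \sum_i \matrix_(s, t) f i s t.
  apply/matrixP => s t; rewrite !mxE summxE (bigD1 (a s).1.2) //= big1 ?addr0.
    by rewrite mxE /f eqxx eq_sym.
  by move=> i /negPf isf; rewrite mxE /f eq_sym isf.
have := hankel_bound k m; rewrite -lez_nat gez0_abs; last first.
  by rewrite mulr_ge0 // sumr_ge0 // => i _; rewrite ltW.
apply: le_trans; rewrite -(big_morph Posz PoszD (erefl _)) lez_nat.
apply: (@leq_trans (\sum_i \rank (\matrix_(s, t) f i s t))%N).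
  elim/big_rec2: _ => [|i r N _ IH]; first by rewrite mxrank0.
  by apply: leq_trans (mxrank_add _ _) _; rewrite leq_add2l.
apply: leq_sum => i _; apply: leq_trans (rank_ord_mxf _) _.
have ks s : (size (a s).1.1 <= k)%N by exact: (leq_bigmax s).
have mt t : (size (b t).1.2 <= m)%N by exact: (leq_bigmax t).
pose f' s (b : m.-bseq V * 'I_n) := if (a s).1.2 == i
  then G ((a s).1.1 ++ i :: b.1) (a s).2 b.2 else 0.
apply: (@leq_trans (\rank (mxf f'))).
  apply: rank_mxf_cols => t; case bi: ((b t).1.1 == i); last first.
    by right=> s; rewrite /f bi andbF.
  by left; exists (Bseq (mt t), (b t).2) => s; rewrite /f bi andbT.
apply: rank_mxf_rows => s; rewrite /f'; case: eqP => ai; last by right.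
by left; exists (Bseq (ks s), (a s).2) => t.
Qed.
End HankelRank.

(** * The minimal realisation *)

Section Realization.
Variables (K : fieldType) (V : finType) (adj : rel V) (n : nat).
Hypothesis adj_sym : symmetric adj.
Variable G : seq V -> 'M[K]_n.
Hypothesis G_adj : forall u i j v, ~~ adj i j -> G (u ++ [:: i, j & v]) = 0.
Hypothesis G_rel : forall u i v,
  \sum_k G (u ++ [:: i, k, i & v]) + G (rcons u i) *m G (i :: v) = 0.
Variable x : {ffun V -> int}.
Hypotheses (x_gt0 : forall i, 0 < x i) (x_dom : forall i, 0 < cart adj x i).

(** In the state space of dimension [d], the rows of [L u i] are the states reached at [i] by [u],
    and the columns of [R j v] are the observations from [j] along [v]. The second and third clauses
    are minimality: the states span, and the observations separate them. *)
Lemma hankel_factor : exists d (L : seq V -> V -> 'M[K]_(n, d))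
    (R : V -> seq V -> 'M[K]_(d, n)) (e : V -> 'M[K]_d) (b : 'M[K]_d),
  [/\ forall u i j v, L u i *m R j v = if i == j then G (u ++ i :: v) else 0,
      forall m (Z : 'M_(d, m)), (forall u i, L u i *m Z = 0) -> Z = 0 &
      forall m (Z : 'M_(m, d)), (forall i v, Z *m R i v = 0) -> Z = 0] /\
  [/\ forall u i j, L u i *m e j = if i == j then L u i else 0,
      forall i j v, e j *m R i v = if i == j then R i v else 0,
      forall u i, L u i *m b = \sum_j L (rcons u i) j &
      forall j v, b *m R j v = \sum_i R i (j :: v)].
Proof.
have [d [l [r [lr [a la] rT]]]] :=
  finite_rank_factor (hankel_fun_rank adj_sym G_adj G_rel x_gt0 x_dom).
(* Operators on rows and on columns that are adjoint with respect to the Hankel matrix descend to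
   one operator on the state space: the states [l (a k)] form the standard basis, and the
   observations separate. *)
have op (s : seq V * V * 'I_n -> 'rV[K]_d) (t : V * seq V * 'I_n -> 'cV[K]_d) :
    (forall x y, s x *m r y = l x *m t y) ->
    exists b, (forall x, l x *m b = s x) /\ forall y, b *m r y = t y.
  move=> st; pose b := \matrix_k s (a k).
  have br y : b *m r y = t y.
    apply/row_matrixP => k; rewrite row_mul rowK st la -rowE //.
  exists b; split=> // z; apply/eqP; rewrite -subr_eq0; apply/eqP.
  by apply: rT => y; rewrite mulmxBl -mulmxA br -st subrr.
pose L u i := \matrix_z l (u, i, z).
pose R i v := \matrix_(k, y) r (i, v, y) k 0.
have rowL u i z : row z (L u i) = l (u, i, z) by exact: rowK.
have colR i v y : col y (R i v) = r (i, v, y).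
  by apply/colP => k; rewrite !mxE.
have rT' m (Z : 'M_(m, d)) : (forall i v, Z *m R i v = 0) -> Z = 0.
  move=> ZR; apply: rT => -[[i v] y]; rewrite -colR colE mulmxA ZR mul0mx //.
have lT m (Z : 'M_(d, m)) : (forall u i, L u i *m Z = 0) -> Z = 0.
  move=> LZ; apply/row_matrixP => k; rewrite row0 rowE -la.
  by case: (a k) => [[u i] z]; rewrite -rowL -row_mul LZ row0.
have ex_e j : exists ej : 'M[K]_d,
    (forall x, l x *m ej = if x.1.2 == j then l x else 0) /\
    (forall y, ej *m r y = if y.1.1 == j then r y else 0).
  apply: op => y z; case: eqP => [yj|yj]; case: eqP => [zj|zj] //.
  - rewrite lr mulmx0 /hankel_fun yj; case: eqP => [jz|_];
    last by rewrite raddf0.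
    by rewrite jz in zj.
  - rewrite lr mul0mx /hankel_fun zj; case: eqP => [jz|_];
    last by rewrite raddf0.
    by rewrite jz in yj.
  - by rewrite mul0mx mulmx0.
have [e eP] := choice ex_e.
(* Adjointness holds because a letter can pass from the end of the first word to the start of the
   second without changing their concatenation. *)
have [b [lb br]] : exists b : 'M[K]_d,
    (forall y, l y *m b = \sum_j l (rcons y.1.1 y.1.2, j, y.2)) /\
    (forall z, b *m r z = \sum_i r (i, z.1.1 :: z.1.2, z.2)).
  apply: op => y z; rewrite mulmx_suml mulmx_sumr.
  rewrite (bigD1 z.1.1) //= big1 ?addr0 => [|j /negPf jz]; last first.
    by rewrite lr /hankel_fun /= jz raddf0.
  rewrite (bigD1 y.1.2) //= [X in _ = _ + X]big1 ?addr0 => [|j /negPf jz];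
    last first.
    by rewrite lr /hankel_fun /= eq_sym jz raddf0.
  by rewrite !lr /hankel_fun /= !eqxx cat_rcons.
exists d, L, R, e, b; split; split=> //.
- move=> u i j v; apply/matrixP => y z.
  have : row y (L u i) *m col z (R j v) = (hankel_fun G (u, i, y) (j, v, z))%:M.
    by rewrite rowL colR lr.
  move/matrixP/(_ 0 0); rewrite !mxE /= /hankel_fun /= => E.
  transitivity (if i == j then G (u ++ i :: v) y z else 0 : K).
    by rewrite mulr1n in E; rewrite -E; apply: eq_bigr => k _; rewrite !mxE.
  by case: eqP => _; rewrite ?mxE.
- move=> u i j; apply/row_matrixP => y; rewrite row_mul rowL (eP j).1 /=.
  by case: eqP => _; rewrite ?rowL ?row0.
- move=> i j v; apply/matrixP => y z.
  have /matrixP/(_ y 0) := (eP j).2 (i, v, z); rewrite /= -colR => E.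
  transitivity ((if i == j then col z (R i v) else 0) y 0); last first.
    by case: eqP => _; rewrite !mxE.
  by rewrite -E !mxE; apply: eq_bigr => k _; rewrite !mxE.
- move=> u i; apply/row_matrixP => y; rewrite row_mul rowL lb /= linear_sum /=.
  by apply: eq_bigr => j _; rewrite rowL.
- move=> j v; apply/matrixP => y z.
  have /matrixP/(_ y 0) := br (j, v, z); rewrite /= -colR => E.
  transitivity ((\sum_i r (i, j :: v, z)) y 0).
    by rewrite -E !mxE; apply: eq_bigr => k _; rewrite !mxE.
  by rewrite !summxE; apply: eq_bigr => k _; rewrite !mxE.
Qed.

Variables (I : {set V}) (E : V -> 'M[K]_n).
Hypotheses (E_M : forall i j, E i *m E j = if i == j then E i else 0)
  (E_in : forall i, i \in I -> E i = 0) (E_sum : \sum_i E i = 1%:M).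
Hypotheses (G_out : forall u i v, i \notin I -> G (u ++ i :: v) = 0)
  (E_adj : forall i j, ~~ adj i j -> E i *m G [::] *m E j = 0)
  (E_adjl : forall i j v, ~~ adj i j -> E i *m G (j :: v) = 0)
  (E_adjr : forall u i j, ~~ adj i j -> G (rcons u i) *m E j = 0)
  (E_rel : forall i, E i *m (G [::] *m G [::] + \sum_k G [:: k]) *m E i = 0).
Hypotheses (n_gt0 : (0 < n)%N)
  (E_brick : forall f, (forall i, E i *m f = f *m E i) ->
     (forall u, G u *m f = f *m G u) -> exists c, f = c%:M).

(** The brick supplies the spaces outside [I] and the state space those inside; the blocks of the
    arrow matrix stay outside [I], enter it, leave it and stay inside. Since the brick generates all
    states, none has a top in [I] and an endomorphism is determined by its block on the brick; since
    it detects all states, there is no socle in [I]. *)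
Lemma realization : exists X : rep K V,
  [/\ is_rep adj X, rbrick X, forall i, i \in I -> no_top X i,
      forall i (v : 'rV_(rsize X)), i \in I -> ~ in_socle X i v &
      forall j, j \notin I -> rdim X j = (\rank (E j))%:Z].
Proof.
have [d [L [R [e [b [[LR LT RT] [Le eR Lb bR]]]]]]] := hankel_factor.
pose bin := \sum_j L [::] j; pose bout := \sum_i R i [::].
have e_M i j : e i *m e j = if i == j then e i else 0.
  apply/eqP; rewrite -subr_eq0; apply/eqP; apply: LT => u k.
  rewrite mulmxBr mulmxA Le; case: (eqVneq k i) => [->|ki].
    by rewrite Le; case: eqP => _; rewrite ?Le ?eqxx ?mulmx0 ?subrr ?subr0.
  by rewrite mul0mx; case: eqP => _; rewrite ?Le ?(negPf ki) ?mulmx0 subrr.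
have e_sum : \sum_i e i = 1%:M.
  apply/eqP; rewrite -subr_eq0; apply/eqP; apply: LT => u k.
  rewrite mulmxBr mulmx1 mulmx_sumr (bigD1 k) //= Le eqxx big1 ?addr0 ?subrr //.
  by move=> j /negPf jk; rewrite Le eq_sym jk.
have e_out i : i \notin I -> e i = 0.
  move=> iI; apply: LT => u k; rewrite Le; case: eqP => // ->.
  by apply: RT => j v; rewrite LR; case: eqP => // _; rewrite G_out.
have bine i : bin *m e i = L [::] i.
  rewrite mulmx_suml (bigD1 i) //= Le eqxx big1 ?addr0 // => j /negPf ji.
  by rewrite Le ji.
have ebout i : e i *m bout = R i [::].
  rewrite mulmx_sumr (bigD1 i) //= eR eqxx big1 ?addr0 // => j /negPf ji.
  by rewrite eR ji.
have Lbe u i j : L u i *m b *m e j = L (rcons u i) j.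
  rewrite Lb mulmx_suml (bigD1 j) //= Le eqxx big1 ?addr0 // => k /negPf kj.
  by rewrite Le kj.
have ebR i j v : e i *m (b *m R j v) = R i (j :: v).
  rewrite bR mulmx_sumr (bigD1 i) //= eR eqxx big1 ?addr0 // => k /negPf ki.
  by rewrite eR ki.
have Lbout u i : L u i *m bout = G (rcons u i).
  rewrite mulmx_sumr (bigD1 i) //= LR eqxx big1 ?addr0 ?cats1 // => j /negPf ji.
  by rewrite LR eq_sym ji.
have binR j v : bin *m R j v = G (j :: v).
  rewrite mulmx_suml (bigD1 j) //= LR eqxx big1 ?addr0 // => i /negPf ij.
  by rewrite LR ij.
have E0e0 i : E i = 0 \/ e i = 0.
  by case: (boolP (i \in I)) => [/E_in|/e_out]; [left|right].
pose X := Rep (fun i => block_mx (E i) 0 0 (e i)) (block_mx (G [::]) bin bout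
  b).
have UX : runit X = 1%:M.
  rewrite scalar_mx_block -E_sum -e_sum /runit /=.
  elim/big_rec3: _ => [|i P Q S _ ->]; first by rewrite block_mx0.
  by rewrite add_block_mx !addr0.
exists X; split.
- split.
  + move=> i j /=; rewrite mulmx_block !(mul0mx, mulmx0, addr0, add0r) E_M e_M.
    by case: eqP => // _; rewrite block_mx0.
  + by rewrite UX mul1mx mulmx1.
  + move=> i j ij /=; rewrite !mulmx_block !(mul0mx, mulmx0, addr0, add0r).
    rewrite E_adj // -(mulmxA (E i)) bine ebout.
    have -> : E i *m L [::] j = 0.
      apply: RT => k v; rewrite -mulmxA LR; case: eqP => _;
        last by rewrite mulmx0.
      by rewrite E_adjl.
    have -> : R i [::] *m E j = 0.
      apply: LT => u k; rewrite mulmxA LR; case: eqP => [ki|_];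
        last by rewrite mul0mx.
      by rewrite cats1 ki E_adjr.
    have -> : e i *m b *m e j = 0.
      apply: LT => u k; rewrite !mulmxA Le; case: eqP => [ki|_];
        last by rewrite !mul0mx.
      rewrite Lbe; apply: RT => z v; rewrite LR; case: eqP => // _.
      by rewrite cat_rcons ki G_adj.
    by rewrite block_mx0.
  + move=> i /=; rewrite -!mulmxA (mulmxA (block_mx _ _ _ b)).
    rewrite !mulmx_block !(mul0mx, mulmx0, addr0, add0r).
    have -> : E i *m ((G [::] *m G [::] + bin *m bout) *m E i) = 0.
      rewrite mulmxA -[RHS](E_rel i); congr (_ *m (_ + _) *m _).
      by rewrite mulmx_sumr; apply: eq_bigr => k _; rewrite binR.
    have -> : e i *m ((bout *m bin + b *m b) *m e i) = 0.
      apply: LT => u k; rewrite mulmxA Le; case: eqP => [->|_];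
        last by rewrite mul0mx.
      rewrite mulmxA mulmxDr mulmxDl !mulmxA Lbout Lb -mulmxA bine.
      rewrite !mulmx_suml; apply: RT => z v; rewrite mulmxDl -mulmxA LR.
      case: (eqVneq i z) => [<-|iz]; last first.
        rewrite mulmx0 add0r mulmx_suml big1 // => j _.
        by rewrite Lbe LR (negPf iz).
      rewrite addrC -[RHS](G_rel u i v); congr (_ + _); rewrite mulmx_suml.
      by apply: eq_bigr => j _; rewrite Lbe LR eqxx !cat_rcons.
    by case: (E0e0 i) => ->; rewrite ?(mul0mx, mulmx0) block_mx0.
- split.
    apply/eqP => /(congr1 (fun M : 'M[K]_(n + d) => \rank M)).
    by rewrite UX mxrank1 mxrank0 => /eqP; rewrite addn_eq0 eqn0Ngt n_gt0.
  move=> f0 [comm_e comm_b _].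
  pose f : 'M[K]_(n + d) := f0.
  pose A : 'M[K]_n := ulsubmx f; pose B : 'M[K]_(n, d) := ursubmx f.
  pose C : 'M[K]_(d, n) := dlsubmx f; pose D : 'M[K]_d := drsubmx f.
  have Ef : f0 = block_mx A B C D by rewrite submxK.
  have {}comm_e i : [/\ E i *m A = A *m E i, E i *m B = B *m e i,
      e i *m C = C *m E i & e i *m D = D *m e i].
    have := comm_e i; rewrite Ef /= !mulmx_block !(mul0mx, mulmx0, addr0,
      add0r).
    exact: eq_block_mx.
  have B0 : B = 0.
    rewrite -[B]mul1mx -E_sum mulmx_suml big1 // => i _.
    by case: (E0e0 i) (comm_e i) => Z [_ EB _ _];
      rewrite ?Z ?mul0mx // EB Z mulmx0.
  have C0 : C = 0.
    rewrite -[C]mul1mx -e_sum mulmx_suml big1 // => i _.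
    by case: (E0e0 i) (comm_e i) => Z [_ _ EC _];
      rewrite ?Z ?mul0mx // EC Z mulmx0.
  move: comm_b; rewrite Ef B0 C0 /= !mulmx_block !(mul0mx, mulmx0, addr0,
    add0r).
  move=> /eq_block_mx[GA binD boutA bD].
  (* Induction along the word that reaches the state: the block [D] on the states is dictated by
     [A]. *)
  have LD u i : L u i *m D = A *m L u i.
    have [_ _ _ eD] := comm_e i; elim/last_ind: u i eD => [|u j IH] i eD.
      by rewrite -bine -mulmxA eD mulmxA binD mulmxA.
    have [_ _ _ eD'] := comm_e j.
    by rewrite -Lbe -!mulmxA eD (mulmxA b) bD !mulmxA (IH j eD').
  have [c Ac] : exists c, A = c%:M.
    apply: E_brick => [i|u]; first by have [] := comm_e i.
    case: (lastP u) => [|{}u i]; first exact: GA.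
    by rewrite -Lbout -mulmxA boutA mulmxA LD mulmxA.
  exists c; rewrite UX scale_scalar_mx mulr1 scalar_mx_block Ac; congr block_mx.
  apply/eqP; rewrite -subr_eq0; apply/eqP; apply: LT => u i.
  by rewrite mulmxBr LD Ac scalar_mxC subrr.
- move=> i iI; rewrite /no_top submxE;
  have := mulmx_coker (rarr X *m rvert X i).
  move: (cokermx _) => Z0; pose Z : 'M[K]_(n + d) := Z0; rewrite -[Z0]/Z.
  rewrite -[Z]vsubmxK /=; move: (usubmx Z) (dsubmx Z) => Zu Zd.
  rewrite (E_in iI) mulmx_block !(mul0mx, mulmx0, addr0, add0r) !mul_block_col.
  rewrite !(mul0mx, mulmx0, addr0, add0r) => /eqP.
  rewrite col_mx_eq0 => /andP[/eqP binZ /eqP bZ].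
  suff -> : e i *m Zd = 0 by rewrite col_mx0.
  apply: LT => u k; rewrite mulmxA Le; case: eqP => [->|_];
    last by rewrite mul0mx.
  case: (lastP u) => [|{}u j]; first by rewrite -bine.
  by rewrite -Lbe -!(mulmxA (L u j)) bZ mulmx0.
- move=> i v0 iI; pose v : 'rV[K]_(n + d) := v0; rewrite -[v0]/v.
  rewrite -[v]hsubmxK; move: (lsubmx v) (rsubmx v) => vl vr [] /=.
  move=> nz; rewrite (E_in iI) !mul_row_block !(mul0mx, mulmx0, addr0, add0r).
  move=> /eq_row_mx[vl0 vre]; rewrite -vl0 !(mul0mx, add0r) => /eqP.
  rewrite row_mx_eq0 => /andP[/eqP vb /eqP vbb].
  case/eqP: nz; rewrite -vl0 (_ : vr = 0) ?row_mx0 //.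
  apply: RT => k w; rewrite -vre -mulmxA eR; case: eqP => [->|_];
    last by rewrite mulmx0.
  case: w => [|j w]; first by rewrite -ebout mulmxA vre.
  by rewrite -ebR !mulmxA vre vbb mul0mx.
- move=> j jI; rewrite ffunE /= rank_diag_block_mx (e_out _ jI) mxrank0.
  by rewrite addn0.
Qed.
End Realization.

(** * The preprojective algebra and its corners *)

Section LinearMaps.
Import VectorInternalTheory.
Variables (K : fieldType) (vT : vectType K).

Definition endmx (f : 'End(vT)) := f2mx f.

Lemma v2r_lfun (f : 'End(vT)) v : v2r (f v) = v2r v *m endmx f.
Proof. by rewrite /endmx unlock /= r2vK. Qed.

Lemma endmx_inj (f g : 'End(vT)) : (forall v, v2r v *m endmx f = v2r v *m endmx
  g) -> f = g.
Proof.
move=> fg; apply/lfunP => v; apply: (can_inj v2rK).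
by rewrite !v2r_lfun.
Qed.

Lemma mx_eqP n m (A B : 'M[K]_(n, m)) : (forall v : 'rV_n, v *m A = v *m B) ->
  A = B.
Proof. by move=> AB; apply/row_matrixP => i; rewrite !rowE. Qed.

Lemma endmxM (f g : 'End(vT)) : endmx (f \o g)%VF = endmx g *m endmx f.
Proof.
apply: mx_eqP => v; rewrite mulmxA -[v]r2vK -!v2r_lfun.
by rewrite comp_lfunE.
Qed.

Lemma endmx1 : endmx \1%VF = 1%:M.
Proof.
apply: mx_eqP => v; rewrite -[v]r2vK -!v2r_lfun.
by rewrite id_lfunE mulmx1.
Qed.

Lemma endmx_linear : linear endmx.
Proof.
move=> a f g; apply: mx_eqP => v; rewrite -[v]r2vK.
rewrite mulmxDr -scalemxAr -!v2r_lfun add_lfunE scale_lfunE.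
by rewrite linearD linearZ.
Qed.
HB.instance Definition _ := GRing.isLinear.Build K 'End(vT) _ _ endmx
  endmx_linear.

Lemma rank_endmx f : \rank (endmx f) = \dim (limg f).
Proof.
have := limg_ker_dim f fullv; rewrite capfv dimvf {1}/dimv /lker mx2vsK
  mxrank_ker.
by have := rank_leq_row (endmx f); rewrite /endmx; lia.
Qed.

End LinearMaps.

Section PathAlgebraBasis.
Variables (K : fieldType) (V : finType) (adj : rel V).
Local Notation PA := (pathAlg K adj).
Implicit Types (f g : PA).

Lemma vertexP_mulE i f p : (vertexP K adj i * f) p = (p.1 == i)%:R * f p.
Proof.
case: p => k w; rewrite -[LHS]/(conv _ _ _) /conv big_ord_recl /= take0 drop0.
rewrite /path_fun /= xpair_eqE andbT big1 ?addr0 // => -[m lt] _ /=.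
by case: w lt => // l w lt; rewrite xpair_eqE andbF mul0r.
Qed.

Lemma mul_vertexPE i f p : (f * vertexP K adj i) p = f p * (last p.1 p.2 ==
  i)%:R.
Proof.
case: p => k w; rewrite -[LHS]/(conv _ _ _) /conv big_ord_recr /= take_size
  drop_size.
rewrite /path_fun /= xpair_eqE andbT big1 ?add0r // => -[m lt] _ /=.
by rewrite xpair_eqE -(size_eq0 (drop _ _)) size_drop subn_eq0 leqNgt lt andbF
  mulr0.
Qed.

Lemma pathE_cons i j w : pathE K adj (i, j :: w) = arrowP K adj i j * pathE K
  adj (j, w).
Proof.
apply: pathAlg_eq => -[k [|l u]].
  by rewrite [RHS]conv_nil /= /path_fun !xpair_eqE !andbF mul0r.
rewrite [RHS]conv_cons /=.
have -> : path_fun K adj (i, [:: j]) (k, [::]) = 0.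
  by rewrite /path_fun xpair_eqE !andbF.
rewrite mul0r add0r; pose c : K := (adj i j && (k == i))%:R.
transitivity (c * conv (vertexP K adj j) (pathE K adj (j, w)) (l, u)).
  rewrite -[conv _ _ _]/((vertexP K adj j * pathE K adj (j, w)) (l, u)).
  rewrite vertexP_mulE /= /path_fun /= -!natrM !mulnb !xpair_eqE eqseq_cons.
  by congr (nat_of_bool _)%:R; case: (adj i j); case: (k == i);
    case: (l == j); case: (u == w); case: (path adj j w).
rewrite -convZl; apply: eq_convl => -[m v].
rewrite /= /path_fun /= -natrM mulnb !xpair_eqE eqseq_cons andbT.
by congr (nat_of_bool _)%:R; rewrite -!andbA.
Qed.

Lemma coef_sum (T : Type) (s : seq T) (P : pred T) (F : T -> PA) p :
  (\sum_(t <- s | P t) F t) p = \sum_(t <- s | P t) F t p.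
Proof. by elim/big_rec2: _ => // t y f _ <-. Qed.

Lemma sum_vertexP : \sum_i vertexP K adj i = 1.
Proof.
apply: pathAlg_eq => -[k w]; rewrite coef_sum /= /path_fun /=.
rewrite (bigD1 k) //= xpair_eqE eqxx big1 ?addr0 // => i /negPf ik.
by rewrite xpair_eqE eq_sym ik.
Qed.

Lemma pathE_span f : exists s : seq (V * seq V), f = \sum_(p <- s) f p *: pathE
  K adj p.
Proof.
have [s sf] := coef_fin f; exists (undup s); apply: pathAlg_eq => p.
rewrite coef_sum; have [ps|ps] := boolP (p \in undup s).
  rewrite (bigD1_seq p) ?undup_uniq //= big1 ?addr0 => [|q /negPf qp].
    rewrite /path_fun eqxx andbT; case: (boolP (path adj p.1 p.2)) => [_|np].
      by rewrite mulr1.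
    by rewrite coef_path ?mul0r.
  by rewrite /= /path_fun eq_sym qp andbF mulr0.
rewrite big_seq big1 => [|q qs]; first by rewrite sf // -mem_undup.
rewrite /= /path_fun; case: eqP => [pq|_]; last by rewrite andbF mulr0.
by rewrite pq qs in ps.
Qed.
End PathAlgebraBasis.

Section PreprojectiveElements.
Variables (K : fieldType) (Delta : ADE).
Local Notation vtx := 'I_(rank Delta).
Local Notation PP := (preproj K Delta).
Local Notation adj := (@adjacent Delta).
Implicit Types (i j k : vtx) (y z : PP).

Definition pquot (f : doublePathAlg K Delta) : PP := qpi _ f.

Lemma pquotM f g : pquot (f * g) = pquot f * pquot g.
Proof. exact: qpiM. Qed.

Lemma pquot_linear : linear pquot.
Proof.
move=> a f g; rewrite /pquot qpiD; congr (_ + _); exact: qpiZ.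
Qed.
HB.instance Definition _ :=
  GRing.isLinear.Build K (doublePathAlg K Delta) PP *:%R pquot pquot_linear.

Lemma pquot1 : pquot 1 = 1. Proof. by []. Qed.

Definition arrow i j : PP := pquot (darrow K i j).

Lemma sum_vertex : \sum_i vertex K i = 1 :> PP.
Proof. by rewrite -pquot1 -(sum_vertexP K adj) raddf_sum. Qed.

Lemma mulr_sum_vertex y z : y * z = \sum_i y * vertex K i * z.
Proof. by rewrite -[y in LHS]mulr1 -sum_vertex mulr_sumr mulr_suml. Qed.

Lemma vertex_arrow i j k :
  vertex K i * arrow j k = if i == j then arrow j k else 0.
Proof.
rewrite -[vertex K i]/(pquot _) -pquotM.
rewrite (_ : dvertex K i * darrow K j k = if i == j then darrow K j k else 0).
  by case: eqP; rewrite ?raddf0.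
apply: pathAlg_eq => p; rewrite vertexP_mulE.
have [->|np] := eqVneq p (j, [:: k]).
  by rewrite /= eq_sym; case: eqP => _; rewrite ?mul1r ?mul0r.
have np0 : darrow K j k p = 0 by rewrite /= /path_fun (negPf np) andbF.
by rewrite np0 mulr0; case: eqP.
Qed.

Lemma arrow_vertex i j k :
  arrow j k * vertex K i = if k == i then arrow j k else 0.
Proof.
rewrite -[vertex K i]/(pquot _) -pquotM.
rewrite (_ : darrow K j k * dvertex K i = if k == i then darrow K j k else 0).
  by case: eqP; rewrite ?raddf0.
apply: pathAlg_eq => p; rewrite mul_vertexPE.
have [->|np] := eqVneq p (j, [:: k]).
  by rewrite /=; case: eqP => _; rewrite ?mulr1 ?mulr0.
have np0 : darrow K j k p = 0 by rewrite /= /path_fun (negPf np) andbF.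
by rewrite np0 mul0r; case: eqP.
Qed.

Lemma arrow_adj i j : ~~ adjacent i j -> arrow i j = 0.
Proof.
move=> /negPf ij; rewrite /arrow (_ : darrow K i j = 0) ?raddf0 //.
by apply: pathAlg_eq => p; rewrite /= /path_fun /= ij.
Qed.

Lemma arrow_rel : \sum_i \sum_(j | edge i j)
  (arrow i j * arrow j i - arrow j i * arrow i j) = 0.
Proof.
have : pquot (preproj_relation K Delta) = 0.
  rewrite -(raddf0 pquot); apply/eqP/qpi_eqP; rewrite subr0; exact: ideal_gen.
move=> E; rewrite -[RHS]E /preproj_relation raddf_sum; apply: eq_bigr => i _.
rewrite raddf_sum; apply: eq_bigr => j _.
by rewrite raddfB /= !pquotM.
Qed.

Lemma preproj_path_ind (P : PP -> Prop) :
  P 0 -> (forall a y z, P y -> P z -> P (a *: y + z)) ->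
  (forall i w, P (pquot (pathE K adj (i, w)))) -> forall y, P y.
Proof.
move=> P0 PD Pp y; rewrite -[y]qreprK -/(pquot _).
have [s ->] := pathE_span (qrepr y).
elim: s => [|[i w] s IH]; first by rewrite big_nil raddf0.
by rewrite big_cons linearP; apply: PD.
Qed.

Variable col : vtx -> bool.
Hypotheses (edge_asym : forall i j, edge i j -> ~~ edge j i)
  (edge_col : forall i j, edge i j -> col j = ~~ col i).

(* Rescaling the arrows along a 2-colouring of the diagram removes the signs
   from the preprojective relation. *)
Definition weight i j : K := if edge i j then (-1) ^+ col i else 1.
Definition arrows : PP := \sum_i \sum_j weight i j *: arrow i j.

Lemma weight_unit i j : weight i j * weight i j = 1.
Proof.
by rewrite /weight; case: ifP => _; case: (col i);
  rewrite ?expr0 ?expr1 ?mulrNN mulr1.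
Qed.

Lemma vertex_arrows i j : vertex K i * arrows * vertex K j = weight i j *:
  arrow i j.
Proof.
rewrite /arrows mulr_sumr mulr_suml (bigD1 i) //= [X in _ + X]big1 ?addr0.
  rewrite mulr_sumr mulr_suml (bigD1 j) //= [X in _ + X]big1 ?addr0.
    by rewrite -scalerAr vertex_arrow eqxx -scalerAl arrow_vertex eqxx.
  move=> k /negPf kj; rewrite -scalerAr vertex_arrow eqxx -scalerAl
    arrow_vertex kj.
  by rewrite scaler0.
move=> k /negPf ki; rewrite mulr_sumr mulr_suml big1 // => l _.
by rewrite -scalerAr vertex_arrow eq_sym ki scaler0 mul0r.
Qed.

Lemma vertex_arrows_adj i j : ~~ adjacent i j -> vertex K i * arrows * vertex K
  j = 0.
Proof. by move=> ij; rewrite vertex_arrows arrow_adj // scaler0. Qed.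

Lemma vertexK i : vertex K i * vertex K i = vertex K i.
Proof. by rewrite vertex_mul eqxx. Qed.

(** The round trip from [i] to [k] acquires the sign [(-1) ^+ col i] if [edge i k], and the opposite
    sign if [edge k i], as the colours of [i] and [k] differ. Hence the left side is, up to a global
    sign, the preprojective relation cut down to [i]. *)
Lemma arrows_rel i : vertex K i * arrows * arrows * vertex K i = 0.
Proof.
have -> : vertex K i * arrows * arrows * vertex K i =
    \sum_k (weight i k * weight k i) *: (arrow i k * arrow k i).
  rewrite -mulrA mulr_sum_vertex; apply: eq_bigr => k _.
  rewrite -(vertexK k) (mulrA (_ * arrows)) vertex_arrows -[LHS]mulrA.
  rewrite (mulrA (vertex K k)) vertex_arrows.
  by rewrite -scalerAl -scalerAr scalerA.
have wE k : (weight i k * weight k i) *: (arrow i k * arrow k i) =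
    (-1) ^+ col i *: ((edge i k)%:R *: (arrow i k * arrow k i)
                    - (edge k i)%:R *: (arrow i k * arrow k i)).
  have [aik|aik] := boolP (adjacent i k); last first.
    by rewrite arrow_adj // mul0r !scaler0 subrr scaler0.
  rewrite /weight; case: (boolP (edge i k)) => ik.
    by rewrite (negPf (edge_asym ik)) mulr1 scale1r scale0r subr0.
  have ki : edge k i by move: aik; rewrite /adjacent /= (negPf ik).
  rewrite ki mul1r scale1r scale0r sub0r scalerN (edge_col ki).
  by case: (col k); rewrite /= ?expr0 ?expr1 ?scaleN1r ?opprK ?scale1r.
rewrite (eq_bigr _ (fun k _ => wE k)) -scaler_sumr sumrB.
suff -> : \sum_k (edge i k)%:R *: (arrow i k * arrow k i) =
          \sum_k (edge k i)%:R *: (arrow i k * arrow k i) by rewrite subrr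
            scaler0.
apply/eqP; rewrite -subr_eq0; apply/eqP.
transitivity (vertex K i * (\sum_i \sum_(j | edge i j)
  (arrow i j * arrow j i - arrow j i * arrow i j)) * vertex K i); last first.
  by rewrite arrow_rel mulr0 mul0r.
rewrite mulr_sumr mulr_suml.
have sandwich j k : vertex K i * (arrow j k * arrow k j) * vertex K i =
    if i == j then arrow j k * arrow k j else 0.
  rewrite mulrA vertex_arrow; case: eqP => [->|_]; last by rewrite !mul0r.
  by rewrite -mulrA arrow_vertex eqxx.
rewrite [RHS](eq_bigr (fun j => \sum_(k | edge j k)
   ((if i == j then arrow j k * arrow k j else 0) -
    (if i == k then arrow k j * arrow j k else 0)))); last first.
  move=> j _; rewrite mulr_sumr mulr_suml; apply: eq_bigr => k _.
  by rewrite mulrBr mulrBl !sandwich.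
under [RHS]eq_bigr do rewrite sumrB.
rewrite [RHS]sumrB; congr (_ - _).
  rewrite [RHS](bigD1 i) //= [X in _ = _ + X]big1 ?addr0 => [|j /negPf ji];
    last first.
    by rewrite big1 // => k _; rewrite eq_sym ji.
  rewrite eqxx [RHS]big_mkcond /=; apply: eq_bigr => k _.
  by case: ifP; rewrite ?scale1r ?scale0r.
apply: eq_bigr => j _; case: (boolP (edge j i)) => ji.
  rewrite (bigD1 i) //= eqxx scale1r big1 ?addr0 // => k /andP[_ /negPf ki].
  by rewrite eq_sym ki.
rewrite scale0r big1 // => k jk; case: eqP => // ik.
by rewrite ik jk in ji.
Qed.
End PreprojectiveElements.

(** * The Hankel data of a module over the corner *)

Section CornerModule.
Variables (K : fieldType) (Delta : ADE).
Local Notation vtx := 'I_(rank Delta).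
Local Notation PP := (preproj K Delta).
Local Notation adj := (@adjacent Delta).
Variable col : vtx -> bool.
Hypotheses (edge_asym : forall i j : vtx, edge i j -> ~~ edge j i)
  (edge_col : forall i j : vtx, edge i j -> col j = ~~ col i).
Variables (I : {set vtx}) (M : fdmod (eI K I)).
Implicit Types (i j k : vtx) (p q y z : PP) (u v : seq vtx).

Local Notation ev := (eI_val K I).
Local Notation B := (arrows K col).
Let n := dim M.

Fact cut_subproof y : idem_val (eI K I) * (ev * y * ev) * idem_val (eI K I)
  == ev * y * ev.
Proof. by rewrite /= !mulrA eI_idem -!mulrA eI_idem. Qed.
Definition cut y : corner (eI K I) := Corner (cut_subproof y).

Fact cut_linear : linear cut.
Proof.
move=> a y z; apply: val_inj; rewrite /= (mulrDr ev (a *: y)) -(scalerAr a ev).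
by rewrite (mulrDl (a *: _)) -(scalerAl a).
Qed.
HB.instance Definition _ := GRing.isLinear.Build K PP (corner (eI K I)) *:%R
  cut cut_linear.

(* Left modules become right actions on row vectors, so [actmx] and [word]
   reverse products. *)
Definition actmx y : 'M[K]_n := endmx (act M (cut y)).

Fact actmx_linear : linear actmx.
Proof. by move=> a y z; rewrite /actmx !linearP. Qed.
HB.instance Definition _ := GRing.isLinear.Build K PP 'M[K]_n *:%R actmx
  actmx_linear.

Lemma actmxM y z : actmx (y * ev * z) = actmx z *m actmx y.
Proof.
rewrite /actmx -endmxM -actM; congr (endmx (act M _)).
by apply: val_inj; rewrite /= !mulrA -(mulrA _ ev ev) eI_idem.
Qed.

Lemma actmx1 : actmx 1 = 1%:M.
Proof.
rewrite /actmx (_ : cut 1 = 1) ?act1 ?endmx1 //.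
by apply: val_inj; rewrite /= mulr1 eI_idem.
Qed.

Lemma actmx_evl y : actmx (ev * y) = actmx y.
Proof. by congr (endmx (act M _)); apply: val_inj;
  rewrite /= !mulrA eI_idem. Qed.

Lemma actmx_evr y : actmx (y * ev) = actmx y.
Proof. by congr (endmx (act M _)); apply: val_inj;
  rewrite /= -!mulrA eI_idem. Qed.

Lemma vertex_ev i : vertex K i * ev = if i \in I then 0 else vertex K i.
Proof. by rewrite mulrBr mulr1 vertex_mul_sum; case: ifP;
  rewrite ?subrr ?subr0. Qed.

Lemma ev_vertex i : ev * vertex K i = if i \in I then 0 else vertex K i.
Proof. by rewrite mulrBl mul1r vertex_sum_mul; case: ifP;
  rewrite ?subrr ?subr0. Qed.

(** Zero outside [I], so that words may range over all vertices and those that leave [I] contribute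
    nothing. *)
Definition inner i : PP := if i \in I then vertex K i else 0.

Fixpoint word u : PP := if u is i :: u' then word u' * inner i * B else B.

Lemma word_cat u i v : word (u ++ i :: v) = word v * inner i * word u.
Proof. by elim: u => //= k u ->; rewrite !mulrA. Qed.

Lemma sum_inner : \sum_i inner i + ev = 1.
Proof. by rewrite -big_mkcond addrC subrK. Qed.

Lemma inner_arrows i j : ~~ adjacent i j -> inner i * B * inner j = 0.
Proof.
move=> ij; rewrite /inner; case: ifP => _; last by rewrite !mul0r.
by case: ifP => _; rewrite ?mulr0 // vertex_arrows_adj.
Qed.

Definition Emx i := actmx (vertex K i).
Definition Gmx u := actmx (word u).

Lemma Emx_in i : i \in I -> Emx i = 0.
Proof. by move=> iI; rewrite /Emx -actmx_evl ev_vertex iI raddf0. Qed.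

Lemma actmx_vertexl i y : Emx i *m actmx y = if i \in I then 0 else actmx (y *
  vertex K i).
Proof.
rewrite -actmxM -mulrA ev_vertex; case: ifP => _ //; by rewrite mulr0 raddf0.
Qed.

Lemma actmx_vertexr i y : actmx y *m Emx i = if i \in I then 0 else actmx
  (vertex K i * y).
Proof.
rewrite -actmxM vertex_ev; case: ifP => _ //; by rewrite mul0r raddf0.
Qed.

Lemma Emx_M i j : Emx i *m Emx j = if i == j then Emx i else 0.
Proof.
rewrite actmx_vertexl; case: ifP => [iI|_].
  by rewrite (Emx_in iI) if_same.
by rewrite vertex_mul eq_sym; case: eqP => [->|_]; rewrite ?raddf0.
Qed.

Lemma Emx_sum : \sum_i Emx i = 1%:M.
Proof. by rewrite -actmx1 -sum_vertex raddf_sum. Qed.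

Lemma adjacentC : symmetric adj.
Proof. by move=> i j; rewrite /adjacent /= orbC. Qed.

Lemma Gmx_adj u i j v : ~~ adjacent i j -> Gmx (u ++ [:: i, j & v]) = 0.
Proof.
move=> ij; rewrite /Gmx word_cat /= -(mulrA (word v)) -(mulrA (word v)).
by rewrite inner_arrows ?mulr0 ?mul0r ?raddf0 // adjacentC.
Qed.

Lemma Gmx_out u i v : i \notin I -> Gmx (u ++ i :: v) = 0.
Proof.
by move=> /negPf iI; rewrite /Gmx word_cat /inner iI mulr0 mul0r raddf0.
Qed.

Lemma inner_rel i : inner i * B * B * inner i = 0.
Proof. by rewrite /inner; case: ifP => _; rewrite ?mul0r // arrows_rel. Qed.

Lemma mulr_inner_ev p q :
  \sum_k p * inner k * q + p * ev * q = p * q.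
Proof.
by rewrite -mulr_suml -mulr_sumr -(mulrDl (p * _)) -(mulrDr p) sum_inner mulr1.
Qed.

(** In the vanishing square of [B] at [i], the midpoint lies either in [I], which gives the sum, or
    outside, where [ev] cuts the path into a product of two actions. *)
Lemma Gmx_rel u i v :
  \sum_k Gmx (u ++ [:: i, k, i & v]) + Gmx (rcons u i) *m Gmx (i :: v) = 0.
Proof.
rewrite /Gmx -actmxM -raddf_sum -raddfD /=.
rewrite -cats1 word_cat /= (eq_bigr (fun k =>
    word v * inner i * B * inner k * (B * inner i * word u))) => [|k _];
      last first.
  by rewrite word_cat /= !mulrA.
by rewrite mulr_inner_ev !mulrA -!(mulrA (word v)) inner_rel mul0r mulr0 raddf0.
Qed.

Lemma Emx_adj i j : ~~ adjacent i j -> Emx i *m Gmx [::] *m Emx j = 0.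
Proof.
move=> ij; rewrite actmx_vertexl; case: ifP => _; first by rewrite mul0mx.
rewrite actmx_vertexr; case: ifP => // _.
by rewrite mulrA vertex_arrows_adj ?raddf0 // adjacentC.
Qed.

Lemma Emx_adjl i j v : ~~ adjacent i j -> Emx i *m Gmx (j :: v) = 0.
Proof.
move=> ij; rewrite actmx_vertexl; case: ifP => // _ /=.
rewrite /inner; case: ifP => _; last by rewrite mulr0 !mul0r raddf0.
by rewrite -!mulrA (mulrA (vertex K j)) vertex_arrows_adj ?mulr0 ?raddf0 //
  adjacentC.
Qed.

Lemma Emx_adjr u i j : ~~ adjacent i j -> Gmx (rcons u i) *m Emx j = 0.
Proof.
move=> ij; rewrite actmx_vertexr; case: ifP => // _ /=.
rewrite -cats1 word_cat /= /inner; case: ifP => _;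
  last by rewrite mulr0 mul0r mulr0 raddf0.
by rewrite !mulrA vertex_arrows_adj ?mul0r ?raddf0 // adjacentC.
Qed.

Lemma Emx_rel i :
  Emx i *m (Gmx [::] *m Gmx [::] + \sum_k Gmx [:: k]) *m Emx i = 0.
Proof.
rewrite /Gmx -actmxM -raddf_sum -raddfD actmx_vertexl; case: ifP => _;
  first by rewrite mul0mx.
rewrite actmx_vertexr; case: ifP => // _ /=.
rewrite addrC (mulrDl (\sum_k _)) mulr_suml (mulrDr (vertex K i)) mulr_sumr.
rewrite (eq_bigr (fun k => vertex K i * B * inner k * (B * vertex K i)));
  last first.
  by move=> k _; rewrite /= !mulrA.
rewrite (_ : vertex K i * (B * ev * B * vertex K i) =
    vertex K i * B * ev * (B * vertex K i)); last by rewrite !mulrA.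
by rewrite mulr_inner_ev !mulrA arrows_rel // raddf0.
Qed.

(** The corner is generated by the vertices outside [I] and the cut words: cut each path at its
    visits outside [I]. *)
Lemma actmx_comm (f : 'M[K]_n) : (forall i, Emx i *m f = f *m Emx i) ->
  (forall u, Gmx u *m f = f *m Gmx u) -> forall y, actmx y *m f = f *m actmx y.
Proof.
move=> Ef Gf.
pose P y := actmx y *m f = f *m actmx y.
have P0 : P 0 by rewrite /P raddf0 mulmx0 mul0mx.
have PZ a y : P y -> P (a *: y).
  by rewrite /P linearZ /= -scalemxAl -scalemxAr => ->.
have PM y z : P y -> P z -> P (y * ev * z).
  by rewrite /P actmxM => Py Pz; rewrite -mulmxA Py !mulmxA Pz.
pose path i w := pquot (pathE K adj (i, w)).
have vertex_path j w : vertex K j * path j w = path j w.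
  rewrite -[vertex K j]/(pquot _) -pquotM; congr pquot; apply: pathAlg_eq => p.
  rewrite vertexP_mulE; case: eqP => [_|pj]; first by rewrite mul1r.
  have /negPf np : p != (j, w) by apply/eqP => E; case: pj; rewrite E.
  by rewrite mul0r /= /path_fun np andbF.
have path_cons i j w : path i (j :: w) = weight K col i j *: (vertex K i * B *
  path j w).
  rewrite /path pathE_cons pquotM.
  rewrite -[LHS]scale1r -(weight_unit K col i j) -scalerA; congr (_ *: _).
  by rewrite scalerAl -vertex_arrows -(mulrA _ (vertex K j)) vertex_path.
(* The second statement carries an unfinished excursion [v] through [I]: the next vertex extends it
   if it lies in [I] and closes it otherwise. *)
have Ppath w : forall i, P (path i w) /\ forall v, P (word v * path i w).
  elim: w => [|j w IH] i.
    split=> [|v]; first exact: Ef.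
    case: (boolP (i \in I)) => iI.
      by rewrite /P -actmx_evr -mulrA vertex_ev iI mulr0 raddf0 mulmx0 mul0mx.
    have <- : word v * ev * vertex K i = word v * vertex K i.
      by rewrite -mulrA ev_vertex (negPf iI).
    by apply: (@PM); [exact: Gf|exact: Ef].
  rewrite path_cons; split=> [|v].
    apply: (@PZ); case: (boolP (i \in I)) => iI.
      by rewrite /P -actmx_evl !mulrA ev_vertex iI !mul0r raddf0 mulmx0 mul0mx.
    have <- : vertex K i * ev * (word [::] * path j w) = vertex K i * B * path
      j w.
      by rewrite vertex_ev (negPf iI) mulrA.
    by apply: (@PM); [exact: Ef|exact: (IH j).2].
  rewrite -scalerAr; apply: (@PZ); case: (boolP (i \in I)) => iI.
    by have := (IH j).2 (i :: v); rewrite /= /inner iI !mulrA.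
  have <- : word v * ev * (vertex K i * ev * (word [::] * path j w)) =
      word v * (vertex K i * B * path j w).
    by rewrite vertex_ev (negPf iI) -mulrA (mulrA ev) ev_vertex (negPf iI)
      !mulrA.
  apply: (@PM); first exact: Gf.
  by apply: (@PM); [exact: Ef|exact: (IH j).2].
apply: (preproj_path_ind (P := P)) => // [a y z Py Pz|i w];
  last exact: (Ppath w i).1.
have := PZ a _ Py; rewrite /P raddfD /= mulmxDl mulmxDr => ->.
by congr (_ + _).
Qed.

Hypothesis brickM : brick M.

Lemma brick_dim : (0 < n)%N.
Proof.
have [phi [inj _]] := brickM.
rewrite lt0n; apply/eqP => n0; have /eqP := oner_neq0 K; apply.
apply: inj; rewrite raddf0; apply: endmx_inj => w.
apply/rowP => i; suff: false by [].
by move: (ltn_ord i); move: (nat_of_ord i) => m; rewrite -/n n0.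
Qed.

Lemma brick_comm (f : 'M[K]_n) : (forall i, Emx i *m f = f *m Emx i) ->
  (forall u, Gmx u *m f = f *m Gmx u) -> exists c, f = c%:M.
Proof.
move=> Ef Gf; have [phi [phi_inj phiP]] := brickM.
have modhomP (g : 'End(M)) :
    (forall y, actmx y *m endmx g = endmx g *m actmx y) -> is_modhom g.
  move=> gP z; have -> : z = cut (val z).
    by apply: val_inj; rewrite -[RHS]/(idem_val (eI K I) * _ * idem_val (eI K
      I)) cornerl cornerr.
  by apply: endmx_inj => w; rewrite !endmxM; congr (_ *m _); exact: gP.
(* The isomorphism [phi] may send 1 to any nonzero scalar endomorphism, so scalars are measured
   against the preimage [c1] of the identity. *)
have [c1 phi1] : exists c, phi c = \1%VF.
  by apply/phiP/modhomP => y; rewrite endmx1 mulmx1 mul1mx.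
have [c phic] : exists c, phi c = (@Hom K M M f : 'End(M)).
  by apply/phiP/modhomP => y; exact: actmx_comm.
have c1_neq0 : c1 != 0.
  apply: contraTneq brick_dim => c10; rewrite -leqNgt leqn0.
  move: phi1; rewrite c10 raddf0 => /(congr1 (@endmx K M)).
  rewrite raddf0 endmx1 => /(congr1 (fun A : 'M_n => \rank A)).
  by rewrite mxrank0 mxrank1 => <-.
exists (c / c1); have -> : f = endmx (phi c) by rewrite phic.
have -> : c = (c / c1) *: (c1 : K^o) by rewrite /GRing.scale /= divfK.
by rewrite !linearZ /= phi1 endmx1 scalemx1 /GRing.scale /= divfK.
Qed.

Lemma rank_Emx i (iI : i \notin I) : \rank (Emx i) = \dim (limg (act M
  (cornerVertex K (Sub i iI)))).
Proof.
rewrite rank_endmx; congr (\dim (limg (act M _))); apply: val_inj => /=.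
by rewrite -mulrA vertex_ev (negPf iI) ev_vertex (negPf iI).
Qed.

End CornerModule.

(** * Dynkin diagrams *)

Section DominantVector.

Lemma sum_ord_eq m (P : pred 'I_m) (y : nat -> nat) t (c : bool) :
  (forall j : 'I_m, P j -> c /\ j = t :> nat) ->
  (\sum_(j < m | P j) y j <= if c then y t else 0)%N.
Proof.
move=> Pt; have [j0 Pj0|P0] := pickP P; last by rewrite big_pred0.
have [-> j0t] := Pt _ Pj0; rewrite (big_pred1 j0) ?j0t // => j /=.
apply/idP/eqP => [/Pt[_ jt]|-> //]; apply: val_inj.
by rewrite /= jt -j0t.
Qed.

Lemma sum_orb m (P Q : pred 'I_m) (y : nat -> nat) :
  (\sum_(j < m | P j || Q j) y j <=
   \sum_(j < m | P j) y j + \sum_(j < m | Q j) y j)%N.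
Proof.
rewrite [X in (X <= _)%N]big_mkcond [X in (_ <= X + _)%N]big_mkcond.
rewrite [X in (_ <= _ + X)%N]big_mkcond -big_split; apply: leq_sum => j _ /=.
by case: (P j); case: (Q j); rewrite ?leq_addr ?addn0.
Qed.

(** The four terms are the successor on the chain, the end of the branch seen from [b], the
    predecessor on the chain, and [b] seen from the end of the branch. *)
Lemma tree_edge_sum m b (y : nat -> nat) (i : 'I_m) :
  (\sum_(j < m | tree_edge m b i j || tree_edge m b j i) y j <=
   (if i.+1 < m.-1 then y i.+1 else 0) + (if i == b :> nat then y m.-1 else 0) +
   ((if 0 < i < m.-1 then y i.-1 else 0) + (if i == m.-1 :> nat then y b else
     0)))%N.
Proof.
apply: leq_trans (sum_orb _ _ _) _.
apply: leq_add; apply: leq_trans (sum_orb _ _ _) _; apply: leq_add;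
  apply: sum_ord_eq => j.
- by case/andP=> /eqP <- ->.
- by case/andP=> -> /eqP.
- by case/andP=> /eqP -> ->.
- by case/andP=> /eqP -> ->.
Qed.

(* Multiples of the coordinates of the half sum of the positive roots. *)
Definition dominant (Delta : ADE) (k : nat) : nat :=
  match Delta with
  | TypeA n => k.+1 * (n.+1 - k)
  | TypeD n => if k <= n.+1 then 2 * k.+1 * (2 * n + 6 - k) else n.+4 * n.+3
  | TypeE6 => nth 0 [:: 16; 30; 42; 30; 16; 22] k
  | TypeE7 => nth 0 [:: 34; 66; 96; 75; 52; 27; 49] k
  | TypeE8 => nth 0 [:: 92; 182; 270; 220; 168; 114; 58; 136] k
  end%N.

Lemma dominant_gt0 Delta (i : 'I_(rank Delta)) : (0 < dominant Delta i)%N.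
Proof.
case: Delta i => [n|n|||] [i lt] /=; rewrite /rank in lt.
- by rewrite muln_gt0 subn_gt0.
- case: ifP => le; rewrite ?muln_gt0 //= subn_gt0; lia.
- by do 6 (case: i lt => [|i] lt //).
- by do 7 (case: i lt => [|i] lt //).
- by do 8 (case: i lt => [|i] lt //).
Qed.

Lemma dominantP Delta (i : 'I_(rank Delta)) :
  (\sum_(j | adjacent i j) dominant Delta j < 2 * dominant Delta i)%N.
Proof.
case: Delta i => [n|n|||] i.
- apply: leq_ltn_trans (sum_orb _ _ _) _.
  (* At the last vertex the absent successor is harmless, because the formula takes the value 0 at
     [n.+1]. *)
  apply: (@leq_ltn_trans (dominant (TypeA n) i.+1 +
    (if 0 < i then dominant (TypeA n) i.-1 else 0))%N).
    apply: leq_add.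
      by apply: (@sum_ord_eq _ _ _ _ true) => j /eqP.
    by apply: sum_ord_eq => j /eqP ->.
  case: i => [[|i] /= lt]; first by rewrite addn0; lia.
  nia.
- apply: leq_ltn_trans (tree_edge_sum n.+1 (dominant (TypeD n)) i) _.
  case: i => [i lt]; rewrite /= in lt *.
  have [le|gt] := leqP i n.
    have -> : (i.+1 < n.+3)%N by lia.
    have -> : (i == n.+1) = false by lia.
    have -> : (i == n.+3) = false by lia.
    have -> : (i < n.+3)%N by lia.
    rewrite andbT ltnS le (leqW le) addn0 addn0.
    (* The truncated subtractions are rewritten as sums in a common difference, leaving polynomial
       inequalities for [nia]. *)
    have -> : (2 * n + 6 - i.+1 = 2 * (n - i) + i + 5)%N by lia.
    have -> : (2 * n + 6 - i = 2 * (n - i) + i + 6)%N by lia.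
    case: i lt le => [|i] lt le /=; first by nia.
    have -> : (i <= n.+1)%N by lia.
    have -> : (2 * n + 6 - i = 2 * (n - i.+1) + i + 8)%N by lia.
    nia.
  have [E|[E|E]] : i = n.+1 \/ i = n.+2 \/ i = n.+3 by lia.
  - by rewrite E /=; do ?[case: ifP => ?]; try lia; nia.
  - by rewrite E /=; do ?[case: ifP => ?]; try lia; nia.
  - by rewrite E /=; do ?[case: ifP => ?]; try lia; nia.
- apply: leq_ltn_trans (tree_edge_sum 2 (dominant TypeE6) i) _.
  by case: i => [i lt]; do 6 (case: i lt => [|i] lt //).
- apply: leq_ltn_trans (tree_edge_sum 2 (dominant TypeE7) i) _.
  by case: i => [i lt]; do 7 (case: i lt => [|i] lt //).
- apply: leq_ltn_trans (tree_edge_sum 2 (dominant TypeE8) i) _.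
  by case: i => [i lt]; do 8 (case: i lt => [|i] lt //).
Qed.

Definition tree_colour (m b i : nat) : bool := if i == m.-1 then ~~ odd b else
  odd i.

Definition colour (Delta : ADE) (i : 'I_(rank Delta)) : bool :=
  match Delta with
  | TypeA n => odd i
  | TypeD n => tree_colour n.+4 n.+1 i
  | TypeE6 => tree_colour 6 2 i
  | TypeE7 => tree_colour 7 2 i
  | TypeE8 => tree_colour 8 2 i
  end.

Lemma tree_edge_lt m b i j : (b < m.-1)%N -> tree_edge m b i j -> (i < j)%N.
Proof. by move=> bm /orP[/andP[/eqP -> _]//|/andP[/eqP -> /eqP ->]]. Qed.

Lemma tree_edge_colour m b i j : (b < m.-1)%N -> tree_edge m b i j ->
  tree_colour m b j = ~~ tree_colour m b i.
Proof.
move=> bm /orP[/andP[/eqP -> lt]|/andP[/eqP -> /eqP ->]]; rewrite /tree_colour.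
  by rewrite (ltn_eqF lt) (ltn_eqF (ltnW lt)).
by rewrite eqxx (ltn_eqF bm).
Qed.

Lemma edge_lt Delta (i j : 'I_(rank Delta)) : edge i j -> (i < j)%N.
Proof.
case: Delta i j => [n|n|||] i j; try exact: tree_edge_lt.
by move=> /eqP ->.
Qed.

Lemma edge_asym Delta (i j : 'I_(rank Delta)) : edge i j -> ~~ edge j i.
Proof. by move/edge_lt => ij; apply/negP => /edge_lt; rewrite ltnNge ltnW. Qed.

Lemma edge_colour Delta (i j : 'I_(rank Delta)) :
  edge i j -> colour j = ~~ colour i.
Proof.
case: Delta i j => [n|n|||] i j; try exact: tree_edge_colour.
by rewrite /edge /colour => /eqP ->.
Qed.

Lemma adjacent_irr Delta : irreflexive (@adjacent Delta).
Proof. by move=> i; rewrite /adjacent /= orbb; apply/negP => /edge_lt;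
  rewrite ltnn. Qed.

End DominantVector.

(** * The dimension vector of a brick *)

Section SimpleReps.
Variables (K : fieldType) (V : finType) (adj : rel V).

Definition simple_rep (i : V) : rep K V :=
  @Rep K V 1 (fun j => (j == i)%:R%:M) 0.

Lemma simple_rep_unit i : runit (simple_rep i) = 1%:M.
Proof.
rewrite /runit /= (bigD1 i) //= eqxx big1 ?addr0 // => j /negPf ->.
by rewrite raddf0.
Qed.

Lemma is_rep_simple i : is_rep adj (simple_rep i).
Proof.
split=> [j k||j k _|j] /=; rewrite ?mulmx0 ?mul0mx //.
rewrite -scalar_mxM -natrM mulnb; case: (eqVneq j k) => [->|jk];
  rewrite ?andbb //.
case: (eqVneq j i) => [ji|_]; case: (eqVneq k i) => [ki|_]; rewrite ?raddf0 //.
by rewrite ji ki eqxx in jk.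
Qed.

Lemma rbrick_simple i : rbrick (simple_rep i).
Proof.
split=> [|f _]; first by rewrite simple_rep_unit oner_neq0.
by exists (f 0 0); rewrite simple_rep_unit scalemx1 -mx11_scalar.
Qed.

Lemma rdim_simple i : rdim (simple_rep i) = alpha i.
Proof.
apply/ffunP => j; rewrite !ffunE /=; case: eqP => _; first by rewrite mxrank1.
by rewrite raddf0 mxrank0.
Qed.

Lemma rorth_simple i j : i != j -> rorth (simple_rep i) (simple_rep j).
Proof.
move=> /negPf ij f [ef _ _]; have := ef i.
by rewrite /= eqxx ij mul1mx raddf0 mulmx0.
Qed.

Lemma rorth_no_top X i : no_top X i -> rorth X (simple_rep i).
Proof.
move=> /submxP[D tX] f [ef bf _]; have := ef i.
rewrite /= eqxx mulmx1 => <-; rewrite tX -!mulmxA ef /= eqxx mulmx1.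
by rewrite bf /= mulmx0 mulmx0.
Qed.

Lemma rorth_no_socle X i : (forall v, ~ in_socle X i v) -> rorth (simple_rep i)
  X.
Proof.
move=> sX f [ef bf _]; apply/eqP; case: (eqVneq f 0) => // f0; case: (sX f).
split=> //; first by rewrite -ef /= eqxx mul1mx.
by rewrite -bf /= mul0mx.
Qed.
End SimpleReps.

(* If the [alpha i], [i \in I], and [b] are images of simple roots under one
   Weyl group element, they form part of a basis of the root lattice, so the
   coordinates of [b] outside [I] have no common divisor. *)
Lemma restriction_primitive (V : finType) (adj : rel V) (I : {set V}) ws k0
    (k : V -> V) (b g : {ffun V -> int}) (m : int) :
  symmetric adj -> irreflexive adj ->
  b = wact adj ws (alpha k0) ->
  (forall i, i \in I -> alpha i = wact adj ws (alpha (k i))) ->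
  (exists2 j, j \notin I & b j != 0) ->
  (forall j, j \notin I -> b j = g j * m) -> (m %| 1)%Z.
Proof.
move=> adj_sym adj_irr bE kE [j0 j0I bj0] bg.
have wK := wactK adj_irr ws.
(* Otherwise [b] would equal [alpha i], which vanishes outside [I]. *)
have kn i : i \in I -> k i != k0.
  move=> iI; apply: contraNneq bj0 => ki; rewrite bE -ki -kE // ffunE.
  have /negPf -> : j0 != i by apply: contraNneq j0I => ->.
  by [].
have decomp : b = g *~ m + \sum_(i in I) alpha i *~ (b i - g i * m).
  apply/ffunP => j; rewrite ffunE ffunMz sum_ffunE.
  have [jI|jI] := boolP (j \in I).
    rewrite (bigD1 j) //= ffunMz ffunE eqxx mul1r big1 ?addr0 => [|i /andP[_
      /negPf ij]].
      by rewrite addrC subrK.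
    by rewrite ffunMz ffunE eq_sym ij mul0r.
  rewrite big1 ?addr0 ?bg // => i iI; rewrite ffunMz ffunE.
  by case: eqP => [ji|_]; [rewrite ji iI in jI|rewrite mul0r].
(* Apply the inverse Weyl group element and read the coordinate at [k0]: the left side becomes 1,
   the terms over [I] vanish, and the rest is a multiple of [m]. *)
have := congr1 (fun v : {ffun V -> int} => wact adj (rev ws) v k0) decomp.
rewrite [in LHS]bE wK raddfD /= raddfMz /= raddf_sum !ffunE eqxx ffunMz
  sum_ffunE.
rewrite big1 ?addr0 => [E|i iI]; first by apply/dvdzP; eexists; exact: E.
by rewrite raddfMz /= kE // wK ffunMz ffunE eq_sym (negPf (kn i iI)) mul0r.
Qed.

Section Roots.
Variables (R : realType) (Delta : ADE).
Local Notation vtx := 'I_(rank Delta).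
Local Notation adj := (@adjacent Delta).

Definition realvec (v : {ffun vtx -> int}) : rootSpace R Delta :=
  [ffun i => (v i)%:~R].

Lemma realvec_alpha i : realvec (alpha i) = simple_root R i.
Proof. by apply/ffunP => j; rewrite !ffunE; case: eqP. Qed.

Lemma realvec_refl i v : realvec (refl adj i v) = reflection i (realvec v).
Proof.
apply/ffunP => j; rewrite [LHS]ffunE reflE !ffunE rmorphB rmorphM /= /cart.
rewrite rmorphB /= rmorph_sum /= [in (v i *+ 2)%:~R]rmorphMn.
rewrite [X in _ = _ - (_ - X) *: _](eq_bigr (fun k => (v k)%:~R : R)).
  by rewrite mulrC; congr (_ - _ * _); case: (j == i).
by move=> k _; rewrite ffunE.
Qed.

Lemma is_root_wact ws k : is_root (realvec (wact adj ws (alpha k))).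
Proof.
elim: ws => [|i ws IH] /=; first by rewrite realvec_alpha;
  exact: simple_is_root.
by rewrite realvec_refl; exact: reflection_is_root.
Qed.

Lemma is_root_realvec v : is_root v -> exists u, v = realvec u.
Proof.
elim=> [i|i {}v _ [u ->]]; first by exists (alpha i); rewrite realvec_alpha.
by exists (refl adj i u); rewrite realvec_refl.
Qed.

Lemma lattice_inclE (I : {set vtx}) d j :
  lattice_incl R (I := I) d j = (d j)%:~R.
Proof.
have E i : (restr I (simple_root R (val i)) *~ d i) j = (val j == val i)%:R *~
  d i.
  by rewrite ffunMzE !ffunE.
rewrite sum_ffunE (bigD1 j) //= E eqxx big1 ?addr0 // => i ij.
by rewrite E eq_sym (inj_eq val_inj) (negPf ij) mul0rz.
Qed.
End Roots.

Lemma brick_restricted_root (K : fieldType) (Delta : ADE) (I : {set 'I_(rank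
  Delta)})
    (M : fdmod (eI K I)) : brick M ->
  exists ws k0 (k : 'I_(rank Delta) -> 'I_(rank Delta)) (b : {ffun 'I_(rank
    Delta) -> int}),
  [/\ b = wact (@adjacent Delta) ws (alpha k0),
      forall i, i \in I -> alpha i = wact (@adjacent Delta) ws (alpha (k i)),
      forall i, 0 <= b i,
      exists2 j, j \notin I & b j != 0 &
      forall j, dimvec M j = b (val j)].
Proof.
move=> bM; pose x : {ffun 'I_(rank Delta) -> int} := [ffun i => (dominant Delta
  (val i))%:Z].
have x_gt0 i : 0 < x i by rewrite ffunE ltz_nat dominant_gt0.
have x_dom i : 0 < cart (@adjacent Delta) x i.
  rewrite /cart subr_gt0 (eq_bigr (fun j => (dominant Delta (val j))%:Z));
    last first.
    by move=> j _; rewrite ffunE.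
  rewrite -(big_morph Posz PoszD (erefl _)) ffunE mulr2n -PoszD ltz_nat addnn
    -mul2n.
  exact: dominantP.
have sym := @adjacentC Delta; have irr := @adjacent_irr Delta.
have asym := @edge_asym Delta; have ecol := @edge_colour Delta.
have [X [rX bX topX socX dimX]] := realization sym
  (Gmx_adj (@colour Delta) M) (Gmx_rel asym ecol M) x_gt0 x_dom
  (Emx_M M) (@Emx_in _ _ _ M) (Emx_sum M) (Gmx_out (@colour Delta) M)
  (Emx_adj (@colour Delta) M) (Emx_adjl (@colour Delta) M) (Emx_adjr (@colour
    Delta) M)
  (Emx_rel asym ecol M) (brick_dim bM) (brick_comm bM).
pose Y (l : option {i | i \in I}) := if l is Some i then simple_rep K (val i)
  else X.
have [|||ws [k kP]] := semibrick_roots sym irr x_gt0 x_dom (X := Y).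
- by case=> [i|]; [exact: is_rep_simple|exact: rX].
- by case=> [i|]; [exact: rbrick_simple|exact: bX].
- case=> [i|] [j|] // ij.
  + exact: rorth_simple.
  + by apply: rorth_no_socle => v; exact: (socX _ _ (valP i)).
  + by apply: rorth_no_top; exact: (topX _ (valP j)).
(* The value outside [I] is a placeholder. *)
pose k' i := if insub i is Some j then k (Some j) else k None.
exists ws, (k None), k', (rdim X); split.
- exact: kP None.
- move=> i iI; rewrite /k' insubT -(rdim_simple K);
  exact: (kP (Some (Sub i iI))).
- by move=> i; rewrite ffunE.
(* If the dimension vector were zero outside [I], all [Emx i] would vanish, although they sum to the
   identity of a nonzero space. *)
- apply: contrapT => h.
  have := congr1 (fun A : 'M_(dim M) => \rank A) (Emx_sum M).
  rewrite big1 => [|i _].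
    by rewrite mxrank0 mxrank1 => n0; have := brick_dim bM; rewrite -n0.
  have [iI|iI] := boolP (i \in I); first exact: Emx_in.
  apply/eqP; rewrite -mxrank_eq0; apply: contraT => Ei; case: h; exists i => //.
  by rewrite dimX.
- case=> j jI; rewrite ffunE /= dimX // rank_Emx.
  by congr (\dim (limg (act M (cornerVertex K _))))%:Z; exact: val_inj.
Qed.

Theorem corollary1p6 (R : realType) (Delta : ADE) (I : {set 'I_(rank Delta)})
  (M : fdmod (eI (R[i]%C : fieldType) I)) :
  brick M -> primitive_restricted_root (lattice_incl R (dimvec M)).
Proof.
move=> /brick_restricted_root[ws [k0 [k [b [bE kE b_ge0 [j0 j0I bj0] dimM]]]]].
have dE : lattice_incl R (dimvec M) = restr I (realvec R b).
  by apply/ffunP => j; rewrite lattice_inclE dimM !ffunE.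
have d0 : lattice_incl R (dimvec M) != 0.
  apply: contraNneq bj0 => /(congr1 (fun f : restrSpace R I => f (Sub j0 j0I))).
  by rewrite dE !ffunE /= => /eqP; rewrite intr_eq0.
split.
  split=> //; exists (realvec R b) => //; split; first by rewrite bE;
    exact: is_root_wact.
  by move=> i; rewrite ffunE ler0z.
move=> c [c0 [v [/is_root_realvec[g ->] g_ge0] ->]] neq m dm.
have bg j : j \notin I -> b j = g j * m.
  move=> jI; have := congr1 (fun f : restrSpace R I => f (Sub j jI)) dm.
  by rewrite dE ffunMzE !ffunE /= -[_%:~R *~ m]mulrzr -intrM => /intr_inj.
have m1 : (m %| 1)%Z.
  apply: (restriction_primitive (@adjacentC Delta) (@adjacent_irr Delta) bE kE)
    bg.
  by exists j0.
have g0 : 0 <= g j0 by have := g_ge0 j0; rewrite ffunE ler0z.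
have := b_ge0 j0; move: bj0 dm m1; rewrite dvdz1 (bg _ j0I).
(* Only 1 and -1 divide 1. The value -1 is excluded by the signs of [b j0] and [g j0], and 1 would
   make the two restricted roots equal. *)
case: m {bg} => [[|[|m]]|[|m]] //= gn dm _; last by move: g0 gn; lia.
by case/eqP: neq; rewrite dm.
Qed.
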